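(* Consider either the Gaussian model or the Erdős–Rényi model for $m$ graphs, with planted law $\mathsf{P}$, null law $\mathsf{Q}$ (extended as in the context) and aggregate matrix $Y$ as defined in the context. Suppose $m\ge 3$ and let $\epsilon_m=\mathrm{TV}(\mathsf{P}_{X^{2:m}},\mathsf{Q}_{X^{2:m}})$. Then $$\mathrm{TV}(\mathsf{P}_X,\mathsf{Q}_X)\le \mathrm{TV}(\mathsf{P}_{X^1Y},\mathsf{Q}_{X^1Y})+4\,\epsilon_m .$$
   Context: Let $\mathcal{E}_n=\binom{[n]}{2}$ and $\mathfrak{S}_n$ the set of permutations of $[n]$. A permutation $\tau$ acts on $\mathcal{E}_n$ by $\tau(\{i,j\})=\{\tau(i),\tau(j)\}$. An alignment is an $m$-tuple $\pi=(\pi_1,\dots,\pi_m)$ of permutations with $\pi_1=\mathrm{Id}$; put $\pi_{k\ell}=\pi_\ell\circ\pi_k^{-1}$. The observation $X=(X^1,\dots,X^m)$ consists of $m$ random symmetric $n\times n$ matrices with zero diagonal; $X^{2:m}=(X^2,\dots,X^m)$. Planted law $\mathsf{P}$: there is a uniformly distributed random alignment $\pi^\star$ such that, conditioned on $\pi^\star$, the $m$-vectors $(X^1_e,X^2_{\pi^\star_2(e)},\dots,X^m_{\pi^\star_m(e)})$, $e\in\mathcal{E}_n$, are mutually independent, with the following distribution. Gaussian model ($\rho\in[0,1]$): each vector is jointly Gaussian with mean zero, unit variances and all pairwise covariances $\rho$. Erdős–Rényi model ($p,s\in[0,1]$): $X^k_{\pi^\star_k(e)}=X^0_e\,\xi^k_e$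 with $X^0_e\sim\mathrm{Bern}(p)$, $\xi^k_e\sim\mathrm{Bern}(s)$ all mutually independent (and independent of $\pi^\star$). Null law: $\mathsf{Q}_X=\mathsf{P}_{X^1}\otimes\cdots\otimes\mathsf{P}_{X^m}$. Let $\pi^\star_{2:m}=(\pi^\star_{k\ell}:2\le k,\ell\le m)$. The law $\mathsf{Q}$ is extended to a joint law of $(X,\pi^\star_{2:m})$ by requiring that the conditional distribution of $\pi^\star_{2:m}$ given $X$ under $\mathsf{Q}$ depends only on $X^{2:m}$ and equals (a fixed version of) the conditional distribution under $\mathsf{P}$: $\mathsf{Q}_{\pi^\star_{2:m}|X}=\mathsf{Q}_{\pi^\star_{2:m}|X^{2:m}}=\mathsf{P}_{\pi^\star_{2:m}|X^{2:m}}$. Aggregate matrix $Y$, a function of $(X^{2:m},\pi^\star_{2:m})$ under both laws: in the Gaussian model $Y_e=X^2_e+X^3_{\pi^\star_{23}(e)}+\cdots+X^m_{\pi^\star_{2m}(e)}$; in the Erdős–Rényi model $Y_e=X^2_e\vee X^3_{\pi^\star_{23}(e)}\vee\cdots\vee X^m_{\pi^\star_{2m}(e)}$, $e\in\mathcal{E}_n$. Subscripts on $\mathsf{P},\mathsf{Q}$ denote marginal laws of the listed objects; $\mathrm{TV}$ is total variation distance. *)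

(* Defs.v *)
From HB Require Import structures.
From mathcomp Require Import all_boot all_order all_algebra all_fingroup.
From mathcomp Require Import all_classical all_reals all_analysis.

Set Implicit Arguments.
Unset Strict Implicit.
Unset Printing Implicit Defensive.

Import Order.TTheory GRing.Theory Num.Theory.
Import numFieldNormedType.Exports.

Local Open Scope classical_set_scope.
Local Open Scope ring_scope.

(* [I -> T] with the product sigma-algebra. *)
Definition cylinders (I : Type) d (T : measurableType d) : set (set (I -> T)) :=
  \bigcup_(i in [set: I])
    preimage_set_system setT (fun x : I -> T => x i) measurable.

Definition prodspace (I : Type) d (T : measurableType d) : Type :=
  g_sigma_algebraType (@cylinders I d T).

Definition tv d (T : measurableType d) (R : realType)
    (mu nu : set T -> \bar R) : R :=
  sup [set `|fine (mu A) - fine (nu A)| | A in measurable].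

(* For a finite family the product rule over the whole family implies the one
   over subfamilies, by taking some of the [B i] to be the whole space. *)
Definition mutually_independent d (T : measurableType d) d'
    (T' : measurableType d') (R : realType) (P : probability T R)
    (I : finType) (Z : I -> {mfun T >-> T'}) : Prop :=
  forall B : I -> set T', (forall i, measurable (B i)) ->
  P [set w | forall i, B i (Z i w)] =
  (\prod_(i : I) fine (P (Z i @^-1` B i)))%:E.

(* Possibly degenerate; [normal_prob c 0] is not a Dirac mass in the library,
   so that case is separate. *)
Definition is_gaussian (R : realType) (nu : set R -> \bar R) : Prop :=
  (exists c : R, forall A : set R, measurable A -> nu A = (\d_c A)%E) \/
  (exists c s : R, s != 0 /\
     forall A : set R, measurable A -> nu A = normal_prob c s A).

(* A random vector is jointly Gaussian when all the linear combinations of its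
   coordinates are Gaussian. *)
Definition jointly_gaussian (R : realType) (I : finType)
    (mu : probability (prodspace I R) R) : Prop :=
  forall c : I -> R,
    is_gaussian (pushforward mu (fun x : prodspace I R => \sum_i c i * x i)).

Definition gaussian_law (R : realType) (m : nat) (rho : R)
    (mu : probability (prodspace 'I_m R) R) : Prop :=
  [/\ jointly_gaussian mu,
      forall k, 'E_mu[fun x : prodspace 'I_m R => x k]%E = 0%E,
      forall k, 'V_mu[fun x : prodspace 'I_m R => x k]%E = 1%E &
      forall k l, k != l ->
        covariance mu (fun x : prodspace 'I_m R => x k)
                      (fun x : prodspace 'I_m R => x l) = rho%:E].

(* Law of (X^0 xi^1, ..., X^0 xi^m); [Z None] plays the role of X^0 and
   [Z (Some k)] that of xi^k. *)
Definition erdos_renyi_law (R : realType) (m : nat) (p s : R)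
    (mu : probability (prodspace 'I_m R) R) : Prop :=
  exists d (T : measurableType d) (nu : probability T R)
         (Z : option 'I_m -> {mfun T >-> bool}),
  [/\ mutually_independent nu Z,
      forall B, pushforward nu (Z None) B = bernoulli_prob p B,
      forall k B, pushforward nu (Z (Some k)) B = bernoulli_prob s B &
      forall A : set (prodspace 'I_m R), measurable A ->
        mu A = nu [set w | A (fun k => (Z None w)%:R * (Z (Some k) w)%:R)]].

Inductive model (R : realType) : Type :=
| Gaussian of R
| ErdosRenyi of R & R.
Arguments Gaussian {R}.
Arguments ErdosRenyi {R}.

Definition admissible (R : realType) (M : model R) : Prop :=
  match M with
  | Gaussian rho => 0 <= rho <= 1
  | ErdosRenyi p s => 0 <= p <= 1 /\ 0 <= s <= 1
  end.

Definition edge_law (R : realType) (m : nat) (M : model R)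
    (mu : probability (prodspace 'I_m R) R) : Prop :=
  match M with
  | Gaussian rho => gaussian_law rho mu
  | ErdosRenyi p s => erdos_renyi_law p s mu
  end.

Definition edge (n : nat) : Type := {e : {set 'I_n} | #|e| == 2%N}.
HB.instance Definition _ n := Finite.on (edge n).

Lemma edge_act_subproof n (t : {perm 'I_n}) (e : edge n) :
  #|t @: val e| == 2%N.
Proof. by rewrite card_imset; [exact: (valP e) | exact: perm_inj]. Qed.

Definition edge_act n (t : {perm 'I_n}) (e : edge n) : edge n :=
  exist _ (t @: val e) (edge_act_subproof t e).

(* Families of permutations, with the discrete sigma-algebra. *)
Definition permfam (I : finType) (n : nat) : Type := {ffun I -> {perm 'I_n}}.
HB.instance Definition _ I n := Finite.on (permfam I n).
HB.instance Definition _ I n :=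
  isPointed.Build (permfam I n) [ffun=> 1%g].
HB.instance Definition _ I n :=
  @isMeasurable.Build default_measure_display (permfam I n)
    discrete_measurable discrete_measurable0
    discrete_measurableC discrete_measurableU.

(* A symmetric n x n matrix with zero diagonal, as its family of entries indexed
   by the unordered pairs {i, j}. *)
Definition graph (R : realType) (n : nat) : Type := prodspace (edge n) R.

(* Graphs are numbered from 0: X^1, ..., X^m are the components 0, ..., m-1 of
   an observation. *)
Definition later (m : nat) : Type := {k : 'I_m | (0 < k)%N}.
HB.instance Definition _ m := Finite.on (later m).

Definition obs (R : realType) (m n : nat) : Type := prodspace 'I_m (graph R n).

Definition lobs (R : realType) (m n : nat) : Type :=
  prodspace (later m) (graph R n).

(* X^{2:m} *)
Definition rest (R : realType) (m n : nat) (x : obs R m n) : lobs R m n :=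
  fun k => x (val k).

Definition relperm (m n : nat) : Type := permfam (later m * later m)%type n.

(* The family (pi_{kl}), 2 <= k, l <= m. Products of permutations are in
   diagrammatic order, [(s * t) i = t (s i)]. *)
Definition relative (m n : nat) (a : permfam 'I_m n) : relperm m n :=
  [ffun kl : later m * later m => ((a (val kl.1))^-1 * a (val kl.2))%g].

Section model_for_m_graphs.
Context (R : realType) (m n : nat) (hm : (3 <= m)%N).

Definition first : 'I_m := Ordinal (ltnW (ltnW hm)).

Definition second : later m := exist _ (Ordinal (ltnW hm)) isT.

Definition alignments : {set permfam 'I_m n} :=
  [set a : permfam 'I_m n | a first == 1%g]%SET.

(* In the Erdos-Renyi model the entries are 0 or 1, and max is the disjunction. *)
Definition aggregate (M : model R) (x : lobs R m n) (t : relperm m n) :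
    graph R n :=
  fun e => match M with
  | Gaussian _ => \sum_(k : later m) x k (edge_act (t (second, k)) e)
  | ErdosRenyi _ _ =>
      \big[Num.max/0]_(k : later m) x k (edge_act (t (second, k)) e)
  end.

Definition first_and_aggregate (M : model R) (x : obs R m n)
    (a : permfam 'I_m n) : graph R n * graph R n :=
  (x first, aggregate M (rest x) (relative a)).

Context d (T : measurableType d).

(* [pistar] is uniform and, conditionally on it, the vectors
   (X^k_{pi_k(e)})_k, over the edges e, are independent with law [mu]. *)
Definition planted (M : model R) (P : probability T R)
    (X : {mfun T >-> obs R m n}) (pistar : {mfun T >-> permfam 'I_m n}) : Prop :=
  (forall a : permfam 'I_m n, P (pistar @^-1` [set a]) =
     if a \in alignments then (#|alignments|%:R^-1)%:E else 0%E) /\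
  exists mu : probability (prodspace 'I_m R) R, edge_law M mu /\
    forall (a : permfam 'I_m n) (B : edge n -> set (prodspace 'I_m R)),
      a \in alignments -> (forall e, measurable (B e)) ->
      P (pistar @^-1` [set a] `&`
         [set w | forall e, B e (fun k => X w k (edge_act (a k) e))]) =
      (P (pistar @^-1` [set a]) * (\prod_(e : edge n) fine (mu (B e)))%:E)%E.

(* [K] is a version of the conditional law of pi_{2:m} given X^{2:m}. *)
Definition is_posterior (P : probability T R)
    (X : {mfun T >-> obs R m n}) (pistar : {mfun T >-> permfam 'I_m n})
    (K : R.-pker (lobs R m n) ~> (relperm m n)) : Prop :=
  forall (A : set (lobs R m n)) (B : set (relperm m n)), measurable A ->
  P [set w | A (rest (X w)) /\ B (relative (pistar w))] =
  (\int[pushforward P (fun w => rest (X w))]_(x in A) K x B)%E.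

(* The null law of X is the product of the marginals of P, and [K] at X^{2:m}
   is the conditional law of pi_{2:m} given X. *)
Definition null (P Q : probability T R)
    (X : {mfun T >-> obs R m n}) (pistar : {mfun T >-> permfam 'I_m n})
    (K : R.-pker (lobs R m n) ~> (relperm m n)) : Prop :=
  (forall B : 'I_m -> set (graph R n), (forall k, measurable (B k)) ->
     Q [set w | forall k, B k (X w k)] =
     (\prod_(k < m) fine (P [set w | B k (X w k)]))%:E) /\
  (forall (A : set (obs R m n)) (B : set (relperm m n)), measurable A ->
     Q [set w | A (X w) /\ B (relative (pistar w))] =
     (\int[pushforward Q X]_(x in A) K (rest x) B)%E).

End model_for_m_graphs.

(* Main.v *)
From HB Require Import structures.
Require Import Defs.
From mathcomp Require Import all_boot all_order all_algebra all_fingroup.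
From mathcomp Require Import all_classical all_reals all_analysis.
From mathcomp Require Import measurable_realfun ring lra.

Set Implicit Arguments.
Unset Strict Implicit.
Unset Printing Implicit Defensive.

Import Order.TTheory GRing.Theory Num.Theory.
Import numFieldNormedType.Exports.

(** Write [W] for the pair formed by the graphs X^2, ..., X^m and their relative
    alignments, and [Y] for the aggregate, which is a function of [W].

    Under the planted law the first graph depends on [W] through [Y] only. For a
    single edge this is a sufficiency property of the vector (x_1, ..., x_m):
    given x_2, ..., x_m, the law of x_1 is a function [kappa] of their sum in
    the Gaussian model ([gaussian_first_given_aggregate]) and of their maximum
    in the Erdos-Renyi model ([erdos_renyi_first_given_aggregate]). Given the
    whole alignment pi and X^2, ..., X^m, the entries X^1_e are therefore
    independent with laws [kappa] at Y_{pi_2(e)} ([given_alignment]). The permutation pi_2 is not a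
    function of [W], but replacing pi_k by its composition with one and the same
    permutation for all k >= 2 preserves the uniform law, the relative
    alignments and the law of X^2, ..., X^m; so pi_2 is uniform and independent
    of [W], and averaging over it leaves a function of [Y]
    ([planted_conditional]). Under the null law the first graph is independent
    of [W] ([null_first_independent]).

    These two facts give the inequality, by an argument about general
    probabilities on a product ([tv_conditional_independence]). If the density
    of the first graph given [W] is g(x, Y) under P and nu(x) under Q, then for
    an event [A] with sections A_w the integrand 1_{A_w}(x) (g(x, Y) - nu(x)) is
    at most 1_D(x, Y) (g(x, Y) - nu(x)), where [D] is the set of the (x, y) with
    nu(x) <= g(x, y). As [D] only involves (X^1, Y), this bounds P(A) - Q(A) by
    the total variation distance of the laws of (X^1, Y), up to two exchanges of
    the law of [W] under P with the one under Q. Finally [W] is obtained from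
    X^2, ..., X^m by the same kernel under both laws, so the two laws of [W] are
    at most [epsilon_m] apart ([tv_posterior]). The sum of the errors is
    2 [epsilon_m], within the 4 [epsilon_m] of the statement. *)

Local Open Scope classical_set_scope.
Local Open Scope ring_scope.

(** * Product spaces and total variation *)

Lemma measurable_coord (I : Type) d (T : measurableType d) (i : I) :
  measurable_fun setT (fun x : prodspace I T => x i).
Proof.
move=> _ B mB; rewrite setTI; apply: sub_sigma_algebra.
by exists i => //; exists B => //; rewrite setTI.
Qed.

Lemma measurable_fun_prodspace (I : Type) d (T : measurableType d)
    d' (S : measurableType d') (D : set S) (f : S -> prodspace I T) :
  (forall i, measurable_fun D (fun x => f x i)) -> measurable_fun D f.
Proof.
move=> mf mD; apply: (@measurability _ _ S (prodspace I T) D f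
  (@cylinders I d T)) => //.
move=> _ [_ [i _ [B mB <-]] <-]; rewrite setTI; exact: mf.
Qed.

Section total_variation.
Context d (T : measurableType d) (R : realType).
Implicit Types mu nu : probability T R.

Lemma prob_fine_ge0 mu A : 0 <= fine (mu A).
Proof. by rewrite fine_ge0// measure_ge0. Qed.

Lemma tv_has_sup mu nu : has_sup [set `|fine (mu A) - fine (nu A)| | A in measurable].
Proof.
split; first by exists `|fine (mu set0) - fine (nu set0)|; exists set0.
exists 1 => _ [A mA <-].
have le1 (m : probability T R) : fine (m A) <= 1.
  by rewrite -lee_fin fineK ?fin_num_measure// probability_le1.
rewrite ler_norml; apply/andP; split.
  by have := le1 nu; have := prob_fine_ge0 mu A; lra.
by have := le1 mu; have := prob_fine_ge0 nu A; lra.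
Qed.

Lemma tv_ge mu nu A : measurable A -> fine (mu A) - fine (nu A) <= tv mu nu.
Proof.
move=> mA; apply: le_trans (ler_norm _) _.
by apply: ub_le_sup; [have [] := tv_has_sup mu nu|exists A].
Qed.

(** The inequality is needed without the absolute value only: its negative part
    is the inequality for the complement, both measures having mass one. *)
Lemma tv_le mu nu (c : R) :
  (forall A, measurable A -> fine (mu A) - fine (nu A) <= c) -> tv mu nu <= c.
Proof.
move=> H; apply: ge_sup; first by have [] := tv_has_sup mu nu.
move=> _ [A mA <-]; rewrite ler_norml H// andbT.
have := H _ (measurableC mA).
rewrite !probability_setC// !fineB ?fin_num_measure//=; lra.
Qed.

Lemma tvC mu nu : tv mu nu = tv nu mu.
Proof.
congr (sup _); rewrite eqEsubset; split => _ [A mA <-]; exists A => //;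
by rewrite distrC.
Qed.

(** Exchanging [mu] for [nu] under the integral of a function with values in
    [0, 1] costs the positive part of [mu - nu] at most, and the mass of that
    positive part is the value of [mu - nu] on a Hahn set. *)
Lemma tv_integral mu nu (f : T -> \bar R) : measurable_fun setT f ->
  (forall x, 0 <= f x <= 1)%E ->
  (\int[mu]_x f x <= \int[nu]_x f x + (tv mu nu)%:E)%E.
Proof.
move=> mf f01.
have f0 x : setT x -> (0 <= f x)%E by case/andP: (f01 x).
pose s := cadd (charge_of_finite_measure mu)
  (cscale (-1) (charge_of_finite_measure nu)).
have [P [N PN]] := Hahn_decomposition s.
have sE A : s A = (mu A - nu A)%E.
  by rewrite /s /cadd/= /cscale/= mulN1e.
(* Subtraction of extended reals does not cancel, so the Jordan decomposition is
   turned into an equality of sums of two measures. *)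
have swap (a b u v : \bar R) : a \is a fin_num -> b \is a fin_num ->
    u \is a fin_num -> v \is a fin_num -> (u - v = b - a -> u + a = v + b)%E.
  move: a b u v => [a||] [b||] [u||] [v||] //= _ _ _ _ [] ?.
  by congr EFin; lra.
have jE A : measurable A -> (mu A + jordan_neg PN A = nu A + jordan_pos PN A)%E.
  move=> mA.
  have : (mu A - nu A = jordan_pos PN A - jordan_neg PN A)%E.
    transitivity (s A); first by rewrite sE.
    by apply: (etrans (jordan_decomp PN mA)); rewrite /cadd/= /cscale mulN1e.
  by apply: swap; rewrite fin_num_measure.
have key : (\int[mu]_x f x + \int[jordan_neg PN]_x f x =
  \int[nu]_x f x + \int[jordan_pos PN]_x f x)%E.
  have add (m1 m2 : {measure set T -> \bar R}) :
      (\int[m1]_x f x + \int[m2]_x f x = \int[measure_add m1 m2]_x f x)%E.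
    by rewrite ge0_integral_measure_add.
  rewrite !add; apply: eq_measure_integral => A mA _.
  apply: (etrans (measure_addE _ _ _)); apply: etrans (esym (measure_addE _ _ _)).
  exact: jE.
apply: (@le_trans _ _ (\int[mu]_x f x + \int[jordan_neg PN]_x f x)%E).
  by rewrite leeDl// integral_ge0.
rewrite key leeD2l//.
have [[mP _] _ _ _] := PN.
apply: (@le_trans _ _ (jordan_pos PN setT)).
  rewrite -[leRHS]mul1e -integral_cst//; apply: ge0_le_integral => //.
  by move=> x _; case/andP: (f01 x).
rewrite jordan_posE cjordan_posE /crestr0 mem_set//= /crestr setTI.
rewrite [leLHS](_ : _ = mu P - nu P)%E; last exact: sE.
rewrite -[mu P]fineK ?fin_num_measure// -[nu P]fineK ?fin_num_measure//.
by rewrite -EFinB lee_fin tv_ge.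
Qed.

End total_variation.

(** * Approximation by an algebra of events *)

Section approximation.
Context d (T : measurableType d) (R : realType).
Variables (mu : {measure set T -> \bar R}) (C : set (set T)).
Hypotheses (mufin : (mu setT < +oo)%E)
  (Cm : C `<=` measurable) (C0 : C set0) (CC : setC_closed C)
  (CU : setU_closed C).

Definition approximable : set (set T) :=
  [set A | measurable A /\ forall e, 0 < e ->
    exists2 B, C B & (mu (A `+` B) < e%:E)%E].

Lemma measurable_setY (A B : set T) : measurable A -> measurable B -> measurable (A `+` B).
Proof. by move=> mA mB; rewrite setY_def; apply: measurableU; exact: measurableD. Qed.

Lemma measure_setY_le (A B D : set T) : measurable A -> measurable B -> measurable D ->
  (mu (A `+` D) <= mu (A `+` B) + mu (B `+` D))%E.
Proof.
move=> mA mB mD.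
have mAB := measurable_setY mA mB; have mBD := measurable_setY mB mD.
apply: le_trans (measureU2 _ mAB mBD).
apply: le_measure; rewrite ?inE//; try exact: measurable_setY.
  exact: measurableU.
rewrite !setY_def => x/=.
by have [Bx|Bx] := pselect (B x); tauto.
Qed.

Lemma approximableU A B : approximable A -> approximable B ->
  approximable (A `|` B).
Proof.
move=> [mA hA] [mB hB]; split; first exact: measurableU.
move=> e e0; have e20 : 0 < e / 2 by rewrite divr_gt0.
have [A' CA' hA'] := hA _ e20; have [B' CB' hB'] := hB _ e20.
exists (A' `|` B'); first exact: CU.
have mA' := Cm CA'; have mB' := Cm CB'.
rewrite [e](splitr e) EFinD.
apply: le_lt_trans (lte_leD _ hA' (ltW hB')); last first.
  by rewrite ge0_fin_numE ?measure_ge0// (lt_trans hB')// ltry.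
have mAA := measurable_setY mA mA'; have mBB := measurable_setY mB mB'.
apply: le_trans (measureU2 _ mAA mBB).
apply: le_measure; rewrite ?inE.
- by apply: measurable_setY; exact: measurableU.
- exact: measurableU.
by rewrite !setY_def => x/=; tauto.
Qed.

(** The sets that an algebra approximates in measure form a sigma-algebra: the
    measure being finite, a countable union is close to its finite subunions.
    An inequality between finite measures that is stable under small changes
    of the event is thus reduced to the events of a generating algebra. *)
Lemma sigma_algebra_approximable : sigma_algebra setT approximable.
Proof.
split.
- by split => // e e0; exists set0 => //; rewrite setYK measure0.
- move=> A [mA hA]; rewrite setTD; split; first exact: measurableC.
  move=> e /hA[B CB hB]; exists (~` B); first exact: CC.
  rewrite (_ : ~` A `+` ~` B = A `+` B)//.
  rewrite !setY_def; apply/seteqP; split => x/=; last by tauto.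
  by have := @contrapT (A x); have := @contrapT (B x); tauto.
- move=> F hF; have mF k : measurable (F k) by case: (hF k).
  have mUF : measurable (\bigcup_k F k) by exact: bigcupT_measurable.
  split => // e e0; have e20 : 0 < e / 2 by rewrite divr_gt0.
  pose G n := \big[setU/set0]_(k < n) F k.
  have aG n : approximable (G n).
    rewrite /G; elim: n => [|n IH]; last by rewrite big_ord_recr; exact: approximableU.
    by rewrite big_ord0; split => // e' e'0; exists set0 => //; rewrite setYK measure0.
  have mG n : measurable (G n) by case: (aG n).
  pose D n := (\bigcup_k F k) `\` G n.
  have mD n : measurable (D n) by exact: measurableD.
  have D0 : \bigcap_n D n = set0.
    apply/seteqP; split => // x Dx; have [[k _ Fkx] _] := Dx 0%N I.
    have [_ /=] := Dx k.+1 I; apply; rewrite /G -bigcup_mkord.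
    by exists k => //=.
  have Dlim : (mu \o D) n @[n --> \oo] --> 0%E.
    rewrite -(measure0 mu) -D0; apply: nonincreasing_cvg_mu => //.
    - by apply: le_lt_trans mufin; apply: le_measure; rewrite ?inE.
    - by rewrite D0.
    - move=> n k nk; apply/subsetPset => x/= [Ux Gkx]; split => // Gnx; apply: Gkx.
      move: Gnx; rewrite /G -!bigcup_mkord => -[i /= ik Fi]; exists i => //=.
      exact: leq_trans ik nk.
  have [n Dn] : exists n, (mu (D n) < (e / 2)%:E)%E.
    have [N _ hN] : \forall n \near \oo, (mu (D n) < (e / 2)%:E)%E.
      apply: (Dlim [set x | (x < (e / 2)%:E)%E]).
      by apply: open_nbhs_nbhs; split; [exact: open_ereal_lt_ereal|rewrite /= lte_fin].
    by exists N; apply: hN => /=.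
  have [_ /(_ _ e20)[B CB hB]] := aG n.
  exists B => //; apply: le_lt_trans (measure_setY_le mUF (mG n) (Cm CB)) _.
  rewrite [e](splitr e) EFinD; apply: lte_leD; last exact: ltW.
    by rewrite ge0_fin_numE ?measure_ge0// (lt_trans hB)// ltry.
  rewrite setY_def (_ : G n `\` _ = set0) ?setU0//.
  apply/seteqP; split => // x/= []; rewrite /G -bigcup_mkord => -[i _ Fi] [].
  by exists i.
Qed.

End approximation.

(** * Laws and finite partitions *)

Definition law d d' (T : measurableType d) (S : measurableType d')
    (R : realType) (P : probability T R) (f : T -> S)
    (mf : measurable_fun setT f) : probability S R :=
  distribution P (mfun_Sub (mem_set mf)).

Lemma ge0_integral_law d d' (T : measurableType d) (S : measurableType d')
    (R : realType) (P : probability T R) (f : T -> S)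
    (mf : measurable_fun setT f) (C : set S) (g : S -> \bar R) :
  measurable C -> measurable_fun setT g -> (forall x, 0 <= g x)%E ->
  (\int[law P mf]_(x in C) g x = \int[P]_(x in f @^-1` C) g (f x))%E.
Proof.
move=> mC mg g0; rewrite ge0_integral_pushforward//.
exact: measurable_funTS.
Qed.

Lemma measure_partition d (T : measurableType d) (R : realType)
    (mu : {measure set T -> \bar R}) (I : finType) (f : T -> I) (A : set T) :
  (forall i, measurable (A `&` f @^-1` [set i])) ->
  mu A = (\sum_(i : I) mu (A `&` f @^-1` [set i]))%E.
Proof.
move=> mA.
rewrite [in LHS](_ : A = \bigcup_(i in [set` index_enum I]) (A `&` f @^-1` [set i])).
  rewrite measure_fin_bigcup//; last first.
    by move=> i j _ _ [x [[_ /= <-] [_ <-]]].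
  by rewrite -fsbig_seq ?index_enum_uniq.
apply/seteqP; split => x; last by move=> [i _ []].
by move=> Ax; exists (f x) => //=; rewrite mem_index_enum.
Qed.

Lemma integral_setE d (T : measurableType d) (R : realType)
    (mu : {measure set T -> \bar R}) (C : set T) (g : T -> \bar R) :
  (\int[mu]_(x in C) g x = \int[mu]_x ((\1_C x)%:E * g x))%E.
Proof.
rewrite integral_mkcond; apply: eq_integral => x _.
by rewrite patchE indicE; case: (x \in C); rewrite ?mul1e ?mul0e.
Qed.

(** * Total variation under conditional independence *)

Section coded_sets.
Context d1 d2 (S1 : measurableType d1) (S2 : measurableType d2).
Variables (G BB : set (set S1)).
Hypotheses (GE : @measurable d1 S1 = <<s G>>) (GC : setC_closed G)
  (GB : G `<=` BB) (BT : BB setT) (BI : setI_closed BB)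
  (Bm : BB `<=` measurable).

(** Finite unions of rectangles in disjoint form: the first coordinate is only
    looked at through a map [b] to a finite type with fibres in [BB], and the
    section depends on the value of [b]. In this form complements and unions are
    immediate. *)
Definition coded : set (set (S1 * S2)) :=
  [set A | exists (I : finType) (b : S1 -> I) (C : I -> set S2),
    [/\ forall i, BB (b @^-1` [set i]), forall i, measurable (C i) &
        A = [set z | C (b z.1) z.2]]].

Lemma coded_measurable : coded `<=` measurable.
Proof.
move=> _ [I [b [C [hb mC ->]]]].
rewrite (_ : mkset _ = \bigcup_(i in [set: I]) ((b @^-1` [set i]) `*` C i)).
  apply: fin_bigcup_measurable => // i _.
  by apply: measurableX => //; exact: Bm.
apply/seteqP; split => [z /= Cz|z [i _ [/= <-]]//].
by exists (b z.1).
Qed.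

Lemma coded0 : coded set0.
Proof.
exists unit, (fun=> tt), (fun=> set0); split => //.
by move=> i; rewrite (_ : _ @^-1` _ = setT)//; apply/seteqP; split => // x _; case: i.
Qed.

Lemma codedC : setC_closed coded.
Proof.
move=> _ [I [b [C [hb mC ->]]]]; exists I, b, (fun i => ~` C i); split => //.
by move=> i; exact: measurableC.
Qed.

Lemma codedU : setU_closed coded.
Proof.
move=> _ _ [I [b [C [hb mC ->]]]] [I' [b' [C' [hb' mC' ->]]]].
exists (I * I')%type, (fun x => (b x, b' x)), (fun i => C i.1 `|` C' i.2).
split => // [[i j]|i]; last exact: measurableU.
rewrite (_ : _ @^-1` _ = b @^-1` [set i] `&` b' @^-1` [set j]).
  exact: BI.
by apply/seteqP; split => x /= [-> ->].
Qed.

(** A generator [D] of the first sigma-algebra is coded by its indicator, and an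
    event of the second one by a constant map. *)
Lemma sub_coded (F : set (set (S1 * S2))) : sigma_algebra setT F ->
  coded `<=` F -> measurable `<=` F.
Proof.
move=> sF cF.
suff H : <<s preimage_set_system setT fst (@measurable d1 S1) `|`
     preimage_set_system setT snd (@measurable d2 S2) >> `<=` F by exact: H.
apply: smallest_sub => // _ [[B mB <-]|[C mC <-]]; rewrite setTI.
- suff sub : <<s G>> `<=` image_set_system setT fst F.
    by move: mB; rewrite GE => /sub; rewrite /image_set_system /= setTI.
  apply: smallest_sub; first exact: sigma_algebra_image.
  move=> D GD; rewrite /image_set_system /= setTI; apply: cF.
  exists bool, (fun x => `[< D x >]), (fun b => if b then setT else set0).
  split; [|by case|].
    move=> b; apply: GB; case: b.
      rewrite (_ : _ @^-1` _ = D)//.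
      by apply/seteqP; split => x /= /asboolP.
    rewrite (_ : _ @^-1` _ = ~` D); first exact: GC.
    by apply/seteqP; split => x /=; case: asboolP.
  apply/seteqP; split => z /=; first by move=> Dz; rewrite asboolT.
  by case: asboolP.
- apply: cF; exists unit, (fun=> tt), (fun=> C); split => //.
  by move=> i; rewrite (_ : _ @^-1` _ = setT)//; apply/seteqP; split => // x _; case: i.
Qed.

End coded_sets.

Section conditional_independence.
Context d1 d2 d3 (S1 : measurableType d1) (S2 : measurableType d2)
  (S3 : measurableType d3) (R : realType).
Variables (P Q : probability (S1 * S2)%type R) (agg : S2 -> S3).
Hypothesis magg : measurable_fun setT agg.

Lemma measurable_pair_agg :
  measurable_fun setT (fun z : S1 * S2 => (z.1, agg z.2)).
Proof.
apply: measurable_fun_pair; first exact: measurable_fst.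
by apply: measurableT_comp => //; exact: measurable_snd.
Qed.

Local Notation PW := (law P measurable_snd).
Local Notation QW := (law Q measurable_snd).

Variables (G BB : set (set S1)).
Hypotheses (GE : @measurable d1 S1 = <<s G>>) (GC : setC_closed G)
  (GB : G `<=` BB) (BT : BB setT) (BI : setI_closed BB)
  (Bm : BB `<=` measurable).
(* Under [P] the law of the first coordinate given the second is a function of
   [agg], and under [Q] the coordinates are independent. Both are only asked
   for events of the pi-system [BB], and the density [g] may depend on the event:
   no regular conditional law is used. *)
Hypothesis HP : forall B, BB B -> exists g : S3 -> \bar R,
  [/\ measurable_fun setT g, forall y, (0 <= g y)%E &
      forall C, measurable C ->
        P (B `*` C) = (\int[PW]_(x in C) g (agg x))%E].
Hypothesis HQ : forall B C, BB B -> measurable C ->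
  Q (B `*` C) = (Q (B `*` setT) * QW C)%E.

Section coded_bound.
Context (I : finType) (b : S1 -> I).
Hypothesis hb : forall i, BB (b @^-1` [set i]).

Let cset (E : I -> set S2) := [set z : S1 * S2 | E (b z.1) z.2].

Let cset_fibre E i :
  cset E `&` (b \o fst) @^-1` [set i] = (b @^-1` [set i]) `*` E i.
Proof.
by apply/seteqP; split => [z /= [] + <-|z /= [<- ?]].
Qed.

Let measurable_fibre (E : I -> set S2) i : measurable (E i) ->
  measurable ((b @^-1` [set i]) `*` E i).
Proof. by move=> mE; apply: measurableX => //; exact: Bm. Qed.

Let measurable_comp_agg (g : S3 -> \bar R) : measurable_fun setT g ->
  measurable_fun setT (fun x => g (agg x)).
Proof. by move=> mg; exact: measurableT_comp. Qed.

(** The conditional probabilities [g i] of the fibres of [b] sum to one almost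
    surely only. Putting them to zero where their sum exceeds one makes the
    bound hold everywhere, which [tv_integral] requires. *)
Lemma coded_conditional : exists g : I -> S3 -> \bar R,
  [/\ forall i, measurable_fun setT (g i), forall i y, (0 <= g i y)%E,
      forall y, (\sum_i g i y <= 1)%E &
      forall E : I -> set S2, (forall i, measurable (E i)) ->
        P (cset E) = (\int[PW]_x \sum_i (\1_(E i) x)%:E * g i (agg x))%E].
Proof.
have /choice[g0 hg0] : forall i, exists g : S3 -> \bar R,
    [/\ measurable_fun setT g, forall y, (0 <= g y)%E &
      forall C, measurable C ->
        P ((b @^-1` [set i]) `*` C) = (\int[PW]_(x in C) g (agg x))%E].
  by move=> i; exact: HP.
have mg0 i : measurable_fun setT (g0 i) by case: (hg0 i).
have g0_ge0 i y : (0 <= g0 i y)%E by case: (hg0 i).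
have Pg0 i (C : set S2) : measurable C ->
    P ((b @^-1` [set i]) `*` C) = (\int[PW]_(x in C) g0 i (agg x))%E.
  by case: (hg0 i) => _ _; exact.
pose s y := (\sum_i g0 i y)%E.
have ms : measurable_fun setT s by apply: emeasurable_sum.
have s_ge0 y : (0 <= s y)%E by apply: sume_ge0.
(* Both sides have the same integral on every event. *)
have s1 : ae_eq PW setT (cst 1%E) (fun x => s (agg x)).
  apply: integral_ae_eq => //.
  - exact: finite_measure_integrable_cst.
  - exact: measurable_comp_agg.
  move=> C _ mC; rewrite integral_cst// mul1e.
  rewrite /s ge0_integral_sum//; last first.
    by move=> i; apply: measurable_funTS; exact: measurable_comp_agg.
  transitivity (P (cset (fun=> C))).
    by congr (P _); apply/seteqP; split => z.
  rewrite (measure_partition _ (f := b \o fst)) => [|i].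
    by apply: eq_bigr => i _; rewrite cset_fibre; exact: Pg0.
  by rewrite cset_fibre; exact: measurable_fibre.
pose U := [set y | (s y <= 1)%E].
have mU : measurable U.
  by rewrite -[U]setTI; exact: emeasurable_fun_infty_c.
pose g i y := ((\1_U y)%:E * g0 i y)%E.
have mg i : measurable_fun setT (g i).
  by apply: emeasurable_funM => //; apply/measurable_EFinP.
have g_ge0 i y : (0 <= g i y)%E by rewrite mule_ge0// lee_fin.
exists g; split => // [y|E mE].
  rewrite /g -ge0_sume_distrr// indicE.
  have [/set_mem Uy|_] := boolP (y \in U); first by rewrite mul1e.
  by rewrite mul0e.
rewrite (measure_partition _ (f := b \o fst)) => [|i]; last first.
  by rewrite cset_fibre; exact: measurable_fibre.
rewrite ge0_integral_sum//; last 2 first.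
- move=> i; apply: emeasurable_funM; last exact: measurable_comp_agg.
  by apply/measurable_EFinP; exact: measurable_indic.
- by move=> i x _; rewrite mule_ge0// lee_fin.
apply: eq_bigr => i _; rewrite cset_fibre -integral_setE.
apply: (etrans (Pg0 i (E i) (mE i))).
apply: ge0_ae_eq_integral => //.
- by apply: measurable_funTS; exact: measurable_comp_agg.
- by apply: measurable_funTS; exact: measurable_comp_agg.
apply: filterS s1 => x /= /(_ Logic.I)/= s1 _.
by rewrite /g indicE mem_set ?mul1e// /U/= -s1.
Qed.

(** The comparison of likelihoods: [D i] is the event that [g i] is at least the
    null probability [nu i], so replacing [C] by [D] increases the difference
    of densities, and [D] is an event about the first coordinate and [agg]. *)
Lemma coded_tv_bound (C : I -> set S2) : (forall i, measurable (C i)) ->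
  (P (cset C) <= Q (cset C) +
     (tv (law P measurable_pair_agg) (law Q measurable_pair_agg) +
      2 * tv PW QW)%:E)%E.
Proof.
move=> mC; have [g [mg g0 g1 Pg]] := coded_conditional.
pose nu i := Q ((b @^-1` [set i]) `*` setT).
have nu0 i : (0 <= nu i)%E by exact: measure_ge0.
pose U i := [set y | (nu i <= g i y)%E].
have mU i : measurable (U i) by rewrite -[U i]setTI; exact: emeasurable_fun_c_infty.
pose D i := agg @^-1` U i.
have mD i : measurable (D i) by rewrite -[D i]setTI; exact: magg.
pose f (E : I -> set S2) x := (\sum_i (\1_(E i) x)%:E * g i (agg x))%E.
pose h (E : I -> set S2) x := (\sum_i (\1_(E i) x)%:E * nu i)%E.
have term0 (E : I -> set S2) x (a : \bar R) i : (0 <= a)%E ->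
    (0 <= (\1_(E i) x)%:E * a)%E.
  by move=> a0; rewrite mule_ge0// lee_fin.
have mf E : (forall i, measurable (E i)) -> measurable_fun setT (f E).
  move=> mE; apply: emeasurable_sum => i; apply: emeasurable_funM.
    by apply/measurable_EFinP; exact: measurable_indic.
  exact: measurable_comp_agg.
have mh E : (forall i, measurable (E i)) -> measurable_fun setT (h E).
  move=> mE; apply: emeasurable_sum => i; apply: emeasurable_funM => //.
  by apply/measurable_EFinP; exact: measurable_indic.
have f0 E x : (0 <= f E x)%E by apply: sume_ge0 => i _; exact: term0.
have h0 E x : (0 <= h E x)%E by apply: sume_ge0 => i _; exact: term0.
have f1 E x : (f E x <= 1)%E.
  apply: le_trans (g1 (agg x)); apply: lee_sum => i _.
  by rewrite indicE; case: (_ \in _); rewrite ?mul1e// mul0e.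
have Qh E : (forall i, measurable (E i)) -> Q (cset E) = (\int[QW]_x h E x)%E.
  move=> mE; rewrite (measure_partition _ (f := b \o fst)) => [|i]; last first.
    by rewrite cset_fibre; exact: measurable_fibre.
  rewrite ge0_integral_sum//; last 2 first.
  - move=> i; apply: emeasurable_funM => //.
    by apply/measurable_EFinP; exact: measurable_indic.
  - by move=> i x _; exact: term0.
  apply: eq_bigr => i _; rewrite cset_fibre -integral_setE integral_cst//.
  by apply: (etrans (HQ (hb i) (mE i))).
have fh x : (f C x + h D x <= f D x + h C x)%E.
  rewrite -!big_split/=; apply: lee_sum => i _.
  rewrite !indicE.
  have [/set_mem Dx|/negP Dx] := boolP (x \in D i).
    have [Cx|Cx] := boolP (x \in C i); rewrite ?mul1e ?mul0e//.
    by rewrite add0e adde0.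
  rewrite mul0e adde0 mul0e add0e.
  have [Cx|Cx] := boolP (x \in C i); rewrite ?mul1e ?mul0e//.
  rewrite leNgt; apply/negP => gx; apply: Dx.
  by rewrite inE /D /= /U/= ltW.
have tvf E : (forall i, measurable (E i)) ->
    (\int[PW]_x f E x <= \int[QW]_x f E x + (tv PW QW)%:E)%E.
  by move=> mE; apply: tv_integral => [|x]; rewrite ?f0 ?f1//; exact: mf.
have tvf' E : (forall i, measurable (E i)) ->
    (\int[QW]_x f E x <= \int[PW]_x f E x + (tv PW QW)%:E)%E.
  by move=> mE; rewrite tvC; apply: tv_integral => [|x]; rewrite ?f0 ?f1//; exact: mf.
(* The integrals of [f C] and of [f D] are moved from [PW] to [QW] and back,
   at the price of one distance each; at [QW] the inequality is pointwise. *)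
have key : (P (cset C) + Q (cset D) <=
    P (cset D) + Q (cset C) + (2 * tv PW QW)%:E)%E.
  rewrite !Qh// !Pg// -/(f C) -/(f D).
  apply: (@le_trans _ _ (\int[QW]_x f C x + (tv PW QW)%:E + \int[QW]_x h D x))%E.
    by rewrite leeD2r// tvf.
  apply: (@le_trans _ _ (\int[QW]_x f D x + \int[QW]_x h C x + (tv PW QW)%:E))%E.
    rewrite addeAC leeD2r// -!ge0_integralD//; try exact: mf; try exact: mh.
    apply: ge0_le_integral => //; first by move=> x _; rewrite adde_ge0.
    - by apply: emeasurable_funD; [exact: mf|exact: mh].
    - by apply: emeasurable_funD; [exact: mf|exact: mh].
  rewrite mulr_natl mulr2n EFinD [leRHS]addeA leeD2r//.
  rewrite [leRHS]addeAC leeD2r//.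
  exact: tvf'.
have Dtv : (P (cset D) <= Q (cset D) +
    (tv (law P measurable_pair_agg) (law Q measurable_pair_agg))%:E)%E.
  pose A := [set z : S1 * S3 | U (b z.1) z.2].
  have mA : measurable A by apply: (coded_measurable Bm); exists I, b, U; split.
  have := tv_ge (law P measurable_pair_agg) (law Q measurable_pair_agg) mA.
  rewrite lerBlDl -lee_fin EFinD !fineK ?fin_num_measure//.
have mcD : measurable (cset D).
  by apply: (coded_measurable Bm); exists I, b, D; split.
have mcC : measurable (cset C).
  by apply: (coded_measurable Bm); exists I, b, C; split.
move: key Dtv.
rewrite -[P (cset C)]fineK ?fin_num_measure//.
rewrite -[P (cset D)]fineK ?fin_num_measure//.
rewrite -[Q (cset C)]fineK ?fin_num_measure//.
rewrite -[Q (cset D)]fineK ?fin_num_measure//.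
rewrite -!EFinD !lee_fin; lra.
Qed.

End coded_bound.

(** The coded sets approximate all the events for [P + Q]. *)
Theorem tv_conditional_independence :
  tv P Q <= tv (law P measurable_pair_agg) (law Q measurable_pair_agg) +
            2 * tv PW QW.
Proof.
apply: tv_le => A mA; apply/ler_addgt0Pr => e e0.
pose C := coded (S2 := S2) BB.
have mC : C `<=` measurable by exact: coded_measurable.
pose mu := measure_add P Q.
have muE B : mu B = (P B + Q B)%E by exact: measure_addE.
have mufin : (mu setT < +oo)%E.
  by rewrite muE !probability_setT -EFinD ltry.
have [_ /(_ _ e0)[B CB]] : approximable mu C A.
  apply: (@sub_coded _ _ _ _ G BB) mA => //.
    apply: sigma_algebra_approximable => //.
    - exact: coded0.
    - exact: codedC.
    - exact: codedU.
  move=> B CB; split; first exact: mC.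
  by move=> r r0; exists B => //; rewrite setYK measure0.
rewrite [X in (X < _)%E](_ : _ = P (A `+` B) + Q (A `+` B))%E; last exact: muE.
move=> PQAB.
have mB := mC _ CB.
have mAB : measurable (A `+` B) by exact: measurable_setY.
have [I [b [c [hb mc Bc]]]] := CB.
have := coded_tv_bound hb mc; rewrite -Bc => bound.
have PA : (P A <= P B + P (A `+` B))%E.
  apply: le_trans (measureU2 _ mB mAB); apply: le_measure; rewrite ?inE//.
    exact: measurableU.
  by move=> x Ax; rewrite setY_def/=; have [Bx|Bx] := pselect (B x); tauto.
have QB : (Q B <= Q A + Q (A `+` B))%E.
  apply: le_trans (measureU2 _ mA mAB); apply: le_measure; rewrite ?inE//.
    exact: measurableU.
  by move=> x Bx; rewrite setY_def/=; have [Ax|Ax] := pselect (A x); tauto.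
move: PQAB bound PA QB.
rewrite -[P A]fineK ?fin_num_measure// -[P B]fineK ?fin_num_measure//.
rewrite -[Q A]fineK ?fin_num_measure// -[Q B]fineK ?fin_num_measure//.
rewrite -[P (A `+` B)]fineK ?fin_num_measure//.
rewrite -[Q (A `+` B)]fineK ?fin_num_measure//.
rewrite -!EFinD !lee_fin lte_fin /=; lra.
Qed.

End conditional_independence.

(** * Laws are determined by linear forms *)

Section bounded_measurable.
Context d (T : measurableType d) (R : realType).
Implicit Types f g : T -> R.

Definition bounded_measurable f :=
  measurable_fun setT f /\ exists M, forall x, `|f x| <= M.

Lemma bounded_measurable_cst c : bounded_measurable (fun=> c).
Proof. by split => //; exists `|c|. Qed.

Lemma bounded_measurableD f g : bounded_measurable f -> bounded_measurable g ->
  bounded_measurable (fun x => f x + g x).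
Proof.
move=> [mf [M fM]] [mg [N gN]]; split; first exact: measurable_funD.
by exists (M + N) => x; apply: le_trans (ler_normD _ _) _; exact: lerD.
Qed.

Lemma bounded_measurableM f g : bounded_measurable f -> bounded_measurable g ->
  bounded_measurable (fun x => f x * g x).
Proof.
move=> [mf [M fM]] [mg [N gN]]; split; first exact: measurable_funM.
by exists (M * N) => x; rewrite normrM ler_pM.
Qed.

Lemma bounded_measurable_integrable (mu : probability T R) f :
  bounded_measurable f -> mu.-integrable setT (EFin \o f).
Proof.
move=> [mf [M fM]]; apply: measurable_bounded_integrable => //.
  by rewrite -ge0_fin_numE ?measure_ge0// fin_num_measure.
by exists M; split => [|N MN x _ /=]; [exact: num_real|exact: le_trans (ltW MN)].
Qed.

Lemma bounded_cvg_integral (mu : probability T R) (f : nat -> T -> R) g M :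
  (forall n, measurable_fun setT (f n)) -> (forall n x, `|f n x| <= M) ->
  (forall x, f n x @[n --> \oo] --> g x) ->
  (\int[mu]_x f n x)%R @[n --> \oo] --> (\int[mu]_x g x)%R.
Proof.
move=> mf fM fg.
have mg : measurable_fun setT g.
  by apply: (measurable_fun_cvg mf) => x _; exact: fg.
have aecvg : {ae mu, forall x, setT x -> (f n x)%:E @[n --> \oo] --> (g x)%:E}.
  by apply: aeW => x _; apply/cvg_EFin; [exact: nearW|exact: fg].
have aeM : {ae mu, forall x n, setT x -> (`|(f n x)%:E| <= (cst M%:E) x)%E}.
  by apply: aeW => x n _; rewrite lee_fin.
have [ig _ h] := dominated_convergence measurableT
  (fun n => (measurable_EFinP setT (f n)).2 (mf n))
  ((measurable_EFinP setT g).2 mg) aecvg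
  (finite_measure_integrable_cst mu M measurableT) aeM.
by apply: fine_cvg; rewrite fineK//; exact: integrable_fin_num.
Qed.

End bounded_measurable.

Section cramer_wold.
Context (I : finType) (R : realType).
Implicit Types (b : I -> R) (f g h : prodspace I R -> R).

Definition linform b (x : prodspace I R) : R := \sum_i b i * x i.

Lemma measurable_linform b : measurable_fun setT (linform b).
Proof.
apply: measurable_sum => i; apply: measurable_funM => //.
exact: measurable_coord.
Qed.

(** Real characters: as [t] varies, the integrals of these functions carry the
    characteristic function of the linear form. *)
Definition wave b (t : R) (x : prodspace I R) : R := cos (linform b x + t).

Lemma bounded_measurable_wave b t : bounded_measurable (wave b t).
Proof.
split; last by exists 1 => x; exact: cos_max.
apply: measurableT_comp; first exact: (continuous_measurable_fun (@continuous_cos R)).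
by apply: measurable_funD => //; exact: measurable_linform.
Qed.

Lemma waveM b t b' t' x : wave b t x * wave b' t' x =
  2^-1 * (wave (fun i => b i + b' i) (t + t') x +
          wave (fun i => b i - b' i) (t - t') x).
Proof.
rewrite /wave.
have -> : linform (fun i => b i + b' i) x + (t + t') =
    (linform b x + t) + (linform b' x + t').
  rewrite addrACA; congr (_ + _); rewrite /linform -big_split/=.
  by apply: eq_bigr => i _; rewrite mulrDl.
have -> : linform (fun i => b i - b' i) x + (t - t') =
    (linform b x + t) - (linform b' x + t').
  rewrite opprD addrACA; congr (_ + _); rewrite /linform -sumrB.
  by apply: eq_bigr => i _; rewrite mulrBl.
set u := linform b x + t; set v := linform b' x + t'.
by rewrite cosD cosB; field.
Qed.

(** The iterates of this polynomial map [-1, 1] to itself and converge to the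
    sign there: 1 and -1 are attracting fixed points, 0 a repelling one. They
    produce the sign of a function out of sums and products. *)
Definition cubic (s : R) : R := (3 * s - s ^+ 3) / 2.

Lemma subr1_cubic s : 1 - cubic s = (1 - s) ^+ 2 * ((2 + s) / 2).
Proof. by rewrite /cubic; field. Qed.

Lemma addr1_cubic s : 1 + cubic s = (1 + s) ^+ 2 * ((2 - s) / 2).
Proof. by rewrite /cubic; field. Qed.

Lemma cubic_norm s : `|s| <= 1 -> `|cubic s| <= 1.
Proof.
rewrite !ler_norml => /andP[s1 s2]; apply/andP; split.
  by rewrite -subr_ge0 opprK addrC addr1_cubic mulr_ge0 ?sqr_ge0//; lra.
by rewrite -subr_ge0 subr1_cubic mulr_ge0 ?sqr_ge0//; lra.
Qed.

Lemma iter_cubic_norm n s : `|s| <= 1 -> `|iter n cubic s| <= 1.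
Proof. by move=> s1; elim: n => [|n IH] //=; exact: cubic_norm. Qed.

Lemma cvg_iter_cubic s : `|s| <= 1 -> iter n cubic s @[n --> \oo] --> Num.sg s.
Proof.
have pos (u : R) : 0 < u -> u <= 1 -> iter n cubic u @[n --> \oo] --> (1 : R).
  move=> u0 u1.
  (* The distance to 1 shrinks at least by the factor 1 - u / 2 at each step,
   because the iterates stay above [u]. *)
have bnd n : u <= iter n cubic u <= 1 /\ 1 - iter n cubic u <= (1 - u / 2) ^+ n.
    elim: n => [|n [/andP[IH1 IH2] IH3]].
      by rewrite /= lexx u1 expr0; split => //; lra.
    rewrite iterS; set v := iter n cubic u in IH1 IH2 IH3 *.
    have le1 : cubic v <= 1.
      by apply: le_trans (ler_norm _) _; apply: cubic_norm; rewrite ger0_norm; lra.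
    have vv : v <= cubic v.
      rewrite -subr_ge0 (_ : _ - _ = v * (1 - v) * ((1 + v) / 2)).
        by rewrite !mulr_ge0//; lra.
      by rewrite /cubic; field.
    split; first by rewrite le1 (le_trans IH1).
    rewrite exprS; apply: (@le_trans _ _ ((1 - u / 2) * (1 - v))).
      rewrite subr1_cubic -subr_ge0.
      rewrite (_ : _ - _ = (1 - v) * ((v - u) / 2 + v * v / 2)); last by field.
      have v2 : 0 <= v * v by rewrite mulr_ge0//; lra.
      by apply: mulr_ge0; lra.
    by rewrite ler_wpM2l//; lra.
  apply: (@squeeze_cvgr _ _ _ _ (fun n => 1 - (1 - u / 2) ^+ n) (fun=> 1)).
  - apply: nearW => n; have [/andP[_ ->] ?] := bnd n; rewrite andbT; lra.
  - rewrite -[X in _ --> X]subr0; apply: cvgB; first exact: cvg_cst.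
    by apply: cvg_expr; rewrite ger0_norm; lra.
  - exact: cvg_cst.
move=> s1; have [s0|s0|->] := ltrgt0P s.
- by rewrite gtr0_sg//; apply: pos => //; rewrite (le_trans _ s1)// ler_norm.
- rewrite ltr0_sg//.
  have -> : (fun n => iter n cubic s) = (fun n => - iter n cubic (- s)).
    apply/funext => n; elim: n => [|n IH]/=; first by rewrite opprK.
    by rewrite IH /cubic; field.
  apply: cvgN; apply: pos; first by rewrite oppr_gt0.
  by rewrite (le_trans _ s1)// -normrN ler_norm.
- rewrite sgr0 (_ : (fun n => _) = fun=> 0); first exact: cvg_cst.
  by apply/funext; elim => [//|n IH]; rewrite iterS IH /cubic; field.
Qed.

Section multipliers.
Variables mu nu : probability (prodspace I R) R.

Definition same_waves h := forall b t,
  (\int[mu]_x (h x * wave b t x))%R = (\int[nu]_x (h x * wave b t x))%R.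

(** Quantifying over [h] makes multipliers an algebra that is closed under bounded
    limits, so that the indicators of all measurable sets are reached from waves;
    the functions [f] with the same integral under [mu] and [nu] would not be
    closed under products. *)
Definition multiplier f := bounded_measurable f /\
  forall h, bounded_measurable h -> same_waves h ->
    same_waves (fun x => h x * f x).

Let integrable_wave (m : probability (prodspace I R) R) h b t :
  bounded_measurable h ->
  m.-integrable setT (EFin \o (fun x => h x * wave b t x)).
Proof.
move=> bh; apply: bounded_measurable_integrable; apply: bounded_measurableM => //.
exact: bounded_measurable_wave.
Qed.

Lemma same_wavesD g h : bounded_measurable g -> bounded_measurable h ->
  same_waves g -> same_waves h -> same_waves (fun x => g x + h x).
Proof.
move=> bg bh sg sh b t.
have E (m : probability (prodspace I R) R) :
    (\int[m]_x ((g x + h x) * wave b t x) =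
     \int[m]_x (g x * wave b t x) + \int[m]_x (h x * wave b t x))%R.
  rewrite -RintegralD//; try exact: integrable_wave.
  by apply: eq_Rintegral => x _; rewrite mulrDl.
by rewrite !E sg sh.
Qed.

Lemma same_wavesZ c h : bounded_measurable h ->
  same_waves h -> same_waves (fun x => c * h x).
Proof.
move=> bh sh b t.
have E (m : probability (prodspace I R) R) :
    (\int[m]_x (c * h x * wave b t x) = c * \int[m]_x (h x * wave b t x))%R.
  rewrite -RintegralZl//; last exact: integrable_wave.
  by apply: eq_Rintegral => x _; rewrite mulrA.
by rewrite !E sh.
Qed.

Lemma same_waves_wave h b t : bounded_measurable h -> same_waves h ->
  same_waves (fun x => h x * wave b t x).
Proof.
move=> bh sh b' t'.
have E (m : probability (prodspace I R) R) :
    (\int[m]_x (h x * wave b t x * wave b' t' x) =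
     2^-1 * (\int[m]_x (h x * wave (fun i => b i + b' i) (t + t') x) +
             \int[m]_x (h x * wave (fun i => b i - b' i) (t - t') x)))%R.
  rewrite -RintegralD//; try exact: integrable_wave.
  rewrite -RintegralZl//; last first.
    by apply: bounded_measurable_integrable; apply: bounded_measurableD;
      apply: bounded_measurableM => //; exact: bounded_measurable_wave.
  apply: eq_Rintegral => x _.
  by rewrite -mulrA waveM -mulrDr mulrCA.
by rewrite !E !sh.
Qed.

Lemma multiplier_wave b t : multiplier (wave b t).
Proof.
by split=> [|h]; [exact: bounded_measurable_wave|exact: same_waves_wave].
Qed.

Lemma eq_same_waves g h : g =1 h -> same_waves g -> same_waves h.
Proof. by move=> /funext ->. Qed.

Lemma multiplier_cst c : multiplier (fun=> c).
Proof.
split=> [|h bh sh]; first exact: bounded_measurable_cst.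
by apply: eq_same_waves (same_wavesZ c bh sh) => x; rewrite mulrC.
Qed.

Lemma multiplierD f g : multiplier f -> multiplier g ->
  multiplier (fun x => f x + g x).
Proof.
move=> [bf hf] [bg hg]; split=> [|h bh sh]; first exact: bounded_measurableD.
apply: eq_same_waves (same_wavesD _ _ (hf h bh sh) (hg h bh sh)).
- by move=> x; rewrite mulrDr.
- exact: bounded_measurableM.
- exact: bounded_measurableM.
Qed.

Lemma multiplierM f g : multiplier f -> multiplier g ->
  multiplier (fun x => f x * g x).
Proof.
move=> [bf hf] [bg hg]; split=> [|h bh sh]; first exact: bounded_measurableM.
apply: eq_same_waves (hg _ (bounded_measurableM bh bf) (hf h bh sh)) => x.
by rewrite mulrA.
Qed.

Lemma multiplier_cvg (f : nat -> prodspace I R -> R) g M :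
  (forall n, multiplier (f n)) -> (forall n x, `|f n x| <= M) ->
  (forall x, f n x @[n --> \oo] --> g x) -> multiplier g.
Proof.
move=> mf fM fg.
have mmf n : measurable_fun setT (f n) by case: (mf n) => -[].
have mg : measurable_fun setT g.
  by apply: (measurable_fun_cvg mmf) => x _; exact: fg.
split=> [|h bh sh b t].
  split => //; exists M => x.
  have /cvg_lim <- // : `|f n x| @[n --> \oo] --> `|g x| by apply: cvg_norm; exact: fg.
  by apply: limr_le; [apply: is_cvg_norm; apply/cvg_ex; exists (g x); exact: fg
                     |exact: nearW].
have [mh [N hN]] := bh; have [mw [L wL]] := bounded_measurable_wave b t.
have E (m : probability (prodspace I R) R) :
    (\int[m]_x (h x * f n x * wave b t x))%R @[n --> \oo] -->
    (\int[m]_x (h x * g x * wave b t x))%R.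
  apply: (@bounded_cvg_integral _ _ _ _ _ _ (N * M * L)).
  - by move=> n; apply: measurable_funM => //; exact: measurable_funM.
  - by move=> n x; rewrite !normrM ler_pM// ?ler_pM// mulr_ge0.
  - move=> x; apply: cvgM; last exact: cvg_cst.
    by apply: cvgM; [exact: cvg_cst|exact: fg].
apply: (cvg_unique _ (E mu)) => //.
rewrite (_ : (fun n => _) = fun n => (\int[nu]_x (h x * f n x * wave b t x))%R).
  exact: E.
by apply/funext => n; have [_ ->] := mf n.
Qed.

Lemma multiplier_cubic f : multiplier f -> multiplier (fun x => cubic (f x)).
Proof.
move=> mf.
have -> : (fun x => cubic (f x)) =
    (fun x => (fun=> 3 / 2) x * f x + (fun=> - 2^-1) x * (f x * (f x * f x))).
  by apply/funext => x; rewrite /cubic; field.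
apply: multiplierD; apply: multiplierM => //; try exact: multiplier_cst.
by do 2 apply: multiplierM => //.
Qed.

Lemma multiplier_sin i a (L : R) : multiplier (fun x => sin ((x i - a) / L)).
Proof.
have -> : (fun x : prodspace I R => sin ((x i - a) / L)) =
    wave (fun j => (j == i)%:R / L) (- a / L - pi / 2).
  apply/funext => x; rewrite /wave addrA cosBpihalf; congr sin.
  rewrite /linform (bigD1 i)//= big1 ?addr0; last first.
    by move=> j /negbTE->; rewrite !mul0r.
  by rewrite eqxx mulrBl mulrAC mul1r -mulNr.
exact: multiplier_wave.
Qed.

Lemma sgr_norm (u : R) : `|Num.sg u| <= 1.
Proof. by rewrite normr_sg; case: (u != 0). Qed.

(** A square wave is a limit of polynomials in a sine. *)
Lemma multiplier_sg_sin i a (L : R) :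
  multiplier (fun x => Num.sg (sin ((x i - a) / L))).
Proof.
apply: (@multiplier_cvg (fun n x => iter n cubic (sin ((x i - a) / L))) _ 1).
- by elim=> [|n IH]; [exact: multiplier_sin|exact: multiplier_cubic].
- by move=> n x; apply: iter_cubic_norm; exact: sin_max.
- by move=> x; apply: cvg_iter_cubic; exact: sin_max.
Qed.

Lemma sgr_sin (u : R) : `|u| < pi -> Num.sg (sin u) = Num.sg u.
Proof.
rewrite ltr_norml => /andP[u1 u2]; have [u0|u0|->] := ltrgt0P u.
- by rewrite !gtr0_sg// sin_gt0_pi// u0.
- have su : 0 < sin (- u) by rewrite sin_gt0_pi// oppr_gt0 u0 ltrNl.
  by rewrite !ltr0_sg//; rewrite sinN oppr_gt0 in su.
- by rewrite sin0.
Qed.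

(** A square wave of period tending to infinity is eventually the sign. *)
Lemma multiplier_sg i a : multiplier (fun x => Num.sg (x i - a)).
Proof.
apply: (@multiplier_cvg (fun n x => Num.sg (sin ((x i - a) / n.+1%:R))) _ 1).
- by move=> n; exact: multiplier_sg_sin.
- by move=> n x; exact: sgr_norm.
move=> x; apply: cvg_near_cst; near=> n.
have n0 : 0 < n.+1%:R :> R by rewrite ltr0n.
rewrite sgr_sin; first by rewrite sgrM (gtr0_sg (x := _^-1)) ?mulr1// invr_gt0.
rewrite normrM normfV (ger0_norm (ltW n0)) ltr_pdivrMr//.
apply: (@le_lt_trans _ _ n%:R).
  by near: n; exact: nbhs_infty_ger.
apply: (@lt_le_trans _ _ (1 * n.+1%:R)); first by rewrite mul1r ltr_nat.
by rewrite ler_pM2r//; have := pi_ge2 R; lra.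
Unshelve. all: by end_near. Qed.

Definition multiplier_set : set (set (prodspace I R)) :=
  [set A | measurable A /\ multiplier (\1_A : prodspace I R -> R)].

Lemma multiplier_setU A B : multiplier_set A -> multiplier_set B ->
  multiplier_set (A `|` B).
Proof.
move=> [mA hA] [mB hB]; split; first exact: measurableU.
have -> : (\1_(A `|` B) : prodspace I R -> R) =
    (fun x => (\1_A x + \1_B x) + (fun=> -1) x * (\1_A x * \1_B x)).
  apply/funext => x; rewrite !indicE in_setU.
  by case: (x \in A); case: (x \in B) => /=; lra.
apply: multiplierD; first exact: multiplierD.
by apply: multiplierM; [exact: multiplier_cst|exact: multiplierM].
Qed.

Lemma sigma_algebra_multiplier_set : sigma_algebra setT multiplier_set.
Proof.
have h0 : multiplier_set set0.
  by split => //; rewrite indic0; exact: multiplier_cst.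
split => //.
- move=> A [mA hA]; rewrite setTD; split; first exact: measurableC.
  have -> : (\1_(~` A) : prodspace I R -> R) =
      (fun x => (fun=> 1) x + (fun=> -1) x * \1_A x).
    apply/funext => x; rewrite !indicE in_setC.
    by case: (x \in A) => /=; lra.
  apply: multiplierD; first exact: multiplier_cst.
  by apply: multiplierM => //; exact: multiplier_cst.
- move=> F hF; split; first by apply: bigcupT_measurable => k; case: (hF k).
  pose G n := \big[setU/set0]_(k < n) F k.
  have hG n : multiplier_set (G n).
    rewrite /G; elim: n => [|n IH]; first by rewrite big_ord0.
    by rewrite big_ord_recr; exact: multiplier_setU.
  apply: (@multiplier_cvg (fun n => \1_(G n)) _ 1).
  - by move=> n; case: (hG n).
  - by move=> n x; rewrite indicE; case: (_ \in _); rewrite ?normr1 ?normr0.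
  move=> x; have [[k _ Fkx]|nF] := pselect ((\bigcup_k F k) x).
    apply: cvg_near_cst; exists k.+1 => // n /= kn.
    rewrite !indicE !mem_set//; first by exists k.
    by rewrite /G -bigcup_mkord; exists k.
  apply: cvg_near_cst; apply: nearW => n.
  rewrite !indicE !memNset// /G -bigcup_mkord => -[k _ Fk].
  by apply: nF; exists k.
Qed.

(** The indicator of [0 < u] is (sg u + sg u ^ 2) / 2, which gives the half-spaces
    of the coordinates, and they generate. *)
Lemma measurable_multiplier_set : measurable `<=` multiplier_set.
Proof.
apply: smallest_sub; first exact: sigma_algebra_multiplier_set.
move=> _ [i _ [B mB <-]]; rewrite setTI.
suff : measurable `<=` image_set_system setT (fun x : prodspace I R => x i) multiplier_set.
  by move=> /(_ _ mB); rewrite /image_set_system/= setTI.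
rewrite [X in X `<=` _]RGenOInfty.measurableE.
apply: smallest_sub.
  exact: sigma_algebra_image sigma_algebra_multiplier_set.
move=> _ [a ->]; rewrite /image_set_system /= setTI; split.
  by have := measurable_coord (T := R) i measurableT (measurable_itv `]a, +oo[); rewrite setTI.
have -> : (\1_((fun x : prodspace I R => x i) @^-1` `]a, +oo[%classic) : prodspace I R -> R) =
    (fun x => (fun=> 2^-1) x * (Num.sg (x i - a) + Num.sg (x i - a) * Num.sg (x i - a))).
  apply/funext => x; rewrite indicE.
  have -> : (x \in (fun x : prodspace I R => x i) @^-1` `]a, +oo[%classic) = (0 < x i - a).
    by apply/idP/idP; rewrite inE /= in_itv/= andbT subr_gt0.
  by have [u|u|u] := ltrgt0P (x i - a); rewrite ?u ?sgr0 ?(gtr0_sg u) ?(ltr0_sg u) /=; lra.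
apply: multiplierM; first exact: multiplier_cst.
by apply: multiplierD; [|apply: multiplierM]; exact: multiplier_sg.
Qed.

End multipliers.

(** Agreement on the linear forms says that the constant function one is in
    [same_waves]; multiplying it by the indicator of [A] and integrating against
    the wave of the zero form gives [mu A = nu A]. *)
Theorem cramer_wold (mu nu : probability (prodspace I R) R) :
  (forall b A, measurable A ->
     mu (linform b @^-1` A) = nu (linform b @^-1` A)) ->
  forall A, measurable A -> mu A = nu A.
Proof.
move=> same A mA.
have [_ [_ hA]] := measurable_multiplier_set mu nu mA.
have one : same_waves mu nu (fun=> 1).
  move=> b t.
  have E (m : probability (prodspace I R) R) :
      (\int[m]_x (1 * wave b t x) =
       \int[law m (measurable_linform b)]_y cos (y + t))%R.
    rewrite /Rintegral integral_pushforward//=.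
    - by congr fine; apply: eq_integral => x _; rewrite mul1r.
    - exact: measurable_linform.
    - apply/measurable_EFinP; apply: (measurableT_comp (f := @cos R)).
        exact: (continuous_measurable_fun (@continuous_cos R)).
      exact: measurable_funD.
    - exact: (bounded_measurable_integrable m (bounded_measurable_wave b t)).
  rewrite !E /Rintegral; congr fine; apply: eq_measure_integral => B mB _.
  exact: same.
have := hA _ (bounded_measurable_cst _ 1) one (fun=> 0) 0.
have E (m : probability (prodspace I R) R) :
    (\int[m]_x (1 * \1_A x * wave (fun=> 0) 0 x) = fine (m A))%R.
  transitivity (fine (\int[m]_x (\1_A x)%:E)%E); last by rewrite integral_indic// setIT.
  congr fine; apply: eq_integral => x _; rewrite mul1r /wave /linform big1 ?add0r ?cos0 ?mulr1//.
  by move=> i _; rewrite mul0r.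
rewrite !E => mn.
by rewrite -[mu A]fineK ?fin_num_measure// -[nu A]fineK ?fin_num_measure// mn.
Qed.

End cramer_wold.

(** * The normal distribution *)

Section density.
Import HBNNSimple.
Context d (T : measurableType d) (R : realType).
Variables (mu N : {measure set T -> \bar R}) (p : T -> R).
Hypotheses (mp : measurable_fun setT p) (p0 : forall x, 0 <= p x)
  (Np : forall A, measurable A -> N A = (\int[mu]_(x in A) (p x)%:E)%E).

Lemma ge0_integral_density (f : T -> \bar R) :
  measurable_fun setT f -> (forall x, (0 <= f x)%E) ->
  (\int[N]_x f x = \int[mu]_x (f x * (p x)%:E))%E.
Proof.
move=> mf f0; pose f_ := nnsfun_approx measurableT mf.
have fcvg x : (f_ n x)%:E @[n --> \oo] --> f x by apply: cvg_nnsfun_approx.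
have fnd x m n : (m <= n)%N -> (f_ m x <= f_ n x)%R.
  by move=> mn; exact/lefP/nd_nnsfun_approx.
transitivity (limn (fun n => \int[N]_x (f_ n x)%:E))%E.
  rewrite -monotone_convergence//.
  - by apply: eq_integral => y _; apply/esym/cvg_lim.
  - by move=> n; exact/measurable_EFinP/measurable_funP.
  - by move=> n y _; rewrite lee_fin.
  - by move=> y _ m n mn; rewrite lee_fin fnd.
transitivity (limn (fun n => \int[mu]_x ((f_ n x)%:E * (p x)%:E)))%E; last first.
  rewrite -monotone_convergence//.
  - apply: eq_integral => y _; apply/cvg_lim => //.
    by apply: cvgeZr => //; exact: fcvg.
  - move=> n; apply/measurable_EFinP; apply: measurable_funM => //.
  - by move=> n y _; rewrite mule_ge0// lee_fin.
  - by move=> y _ m n mn; rewrite lee_wpmul2r ?lee_fin// fnd.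
congr (limn _); apply/funext => n.
transitivity (\sum_(k \in range (f_ n)) k%:E * N (f_ n @^-1` [set k]))%E.
  by rewrite integralT_nnsfun sintegralE.
transitivity (\sum_(k \in range (f_ n))
    \int[mu]_x (k%:E * ((\1_(f_ n @^-1` [set k]) x)%:E * (p x)%:E)))%E.
  apply: eq_fsbigr => k /set_mem[x _ fx].
  rewrite ge0_integralZl//.
  - by rewrite Np// integral_setE.
  - apply: emeasurable_funM; last exact/measurable_EFinP.
    by apply/measurable_EFinP; exact: measurable_indic.
  - by move=> y _; rewrite mule_ge0// lee_fin.
  - by rewrite lee_fin -fx.
rewrite -ge0_integral_fsum//.
- apply: eq_integral => x _; rewrite fimfunE -fsumEFin// ge0_mule_fsuml.
    by apply: eq_fsbigr => k _; rewrite muleA EFinM.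
  by move=> k; exact: nnfun_muleindic_ge0.
- move=> k; apply: measurable_funeM; apply: emeasurable_funM; last exact/measurable_EFinP.
  by apply/measurable_EFinP; exact: measurable_indic.
- move=> k x _; rewrite muleA mule_ge0 ?lee_fin//.
  exact: nnfun_muleindic_ge0.
Qed.

End density.

Section normal.
Context (R : realType).
Local Notation leb := (@lebesgue_measure R).
Local Notation N01 := (normal_prob (0 : R) 1).

(** By uniqueness of the Lebesgue measure it is enough to look at intervals,
    which an affine map with negative slope turns around. *)
Lemma lebesgue_measure_affine (s c : R) A : s != 0 -> measurable A ->
  leb A = (`|s|%:E * leb [set x | A (s * x + c)%R])%E.
Proof.
move=> s0 mA.
have mf : measurable_fun setT (fun x : R => s * x + c : measurableTypeR R).
  by apply: measurable_funD => //; exact: measurable_funM.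
pose f := @mfun_Sub _ _ (measurableTypeR R) (measurableTypeR R)
  (fun x => s * x + c) (mem_set mf).
have := @lebesgue_measure_unique R (mscale (NngNum (normr_ge0 s)) (pushforward leb f : {measure set (measurableTypeR R) -> \bar R})).
apply; last exact: mA.
move=> _ [[a b]] _ <-.
transitivity (`|s|%:E * leb (f @^-1` `]a, b]%classic))%E; last by [].
rewrite lebesgue_measure_itv/=.
have sN : 0 < `|s| by rewrite normr_gt0.
pose D : set R := if 0 < s then `](a - c) / s, (b - c) / s]%classic
    else `[(b - c) / s, (a - c) / s[%classic.
rewrite [X in leb X](_ : _ = D); last first.
  rewrite /D; case: ltrP => sp; apply/seteqP; split => x /=; rewrite !in_itv/=.
  - by rewrite ltr_pdivrMr// ler_pdivlMr// mulrC ltrBlDr lerBrDr.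
  - by rewrite ltr_pdivrMr// ler_pdivlMr// mulrC ltrBlDr lerBrDr.
  - have {}sp : s < 0 by rewrite lt_neqAle s0.
    by rewrite ltr_ndivlMr// ler_ndivrMr// mulrC ltrBlDr lerBrDr andbC.
  - have {}sp : s < 0 by rewrite lt_neqAle s0.
    by rewrite ltr_ndivlMr// ler_ndivrMr// mulrC ltrBlDr lerBrDr andbC.
rewrite /D; case: ltrP => sp; rewrite lebesgue_measure_itv/= !lte_fin.
- rewrite ltr_pM2r ?invr_gt0// ltrD2r; case: ifP => // _; last by rewrite mule0.
  by rewrite -!EFinB -EFinM gtr0_norm//; congr EFin; field.
- have {}sp : s < 0 by rewrite lt_neqAle s0.
  rewrite ltr_nM2r ?invr_lt0// ltrD2r; case: ifP => // _; last by rewrite mule0.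
  by rewrite -!EFinB -EFinM ltr0_norm//; congr EFin; field.
Qed.

Lemma ge0_integral_affine (s c : R) (F : R -> \bar R) : s != 0 ->
  measurable_fun setT F -> (forall x, (0 <= F x)%E) ->
  (\int[leb]_x F x = `|s|%:E * \int[leb]_x F (s * x + c)%R)%E.
Proof.
move=> s0 mF F0.
have mf : measurable_fun setT (fun x : R => s * x + c : measurableTypeR R).
  by apply: measurable_funD => //; exact: measurable_funM.
pose f := @mfun_Sub _ _ (measurableTypeR R) (measurableTypeR R)
  (fun x => s * x + c) (mem_set mf).
pose m : {measure set (measurableTypeR R) -> \bar R} :=
  mscale (NngNum (normr_ge0 s)) (pushforward leb f).
transitivity (\int[m mf]_x F x)%E.
  apply: eq_measure_integral => A mA _.
  exact: (lebesgue_measure_affine c s0 mA).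
rewrite ge0_integral_mscale//; congr (_ * _)%E.
by rewrite ge0_integral_pushforward.
Qed.

Lemma ge0_integral_normal (c s : R) (F : R -> \bar R) :
  measurable_fun setT F -> (forall x, (0 <= F x)%E) ->
  (\int[normal_prob c s]_x F x = \int[leb]_x (F x * (normal_pdf c s x)%:E))%E.
Proof.
apply: (@ge0_integral_density _ _ _ leb (normal_prob c s) (normal_pdf c s)) => //.
- exact: measurable_normal_pdf.
- by move=> x; exact: normal_pdf_ge0.
Qed.

Lemma normal_pdf_affine (c s x : R) : s != 0 ->
  `|s| * normal_pdf c s (s * x + c) = normal_pdf 0 1 x.
Proof.
move=> s0; rewrite !normal_pdfE ?oner_eq0// /normal_fun mulrA.
have s20 : 0 < s ^+ 2 by rewrite exprn_even_gt0.
have pi0 := pi_gt0 R.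
congr (_ * expR _).
  rewrite /normal_peak -mulrnAr sqrtrM ?ltW// sqrtr_sqr invfM mulrA.
  by rewrite divff ?normr_eq0// mul1r expr1n mul1r.
by rewrite addrK subr0 expr1n; field.
Qed.

Lemma normal_affine (c s : R) (F : R -> \bar R) : s != 0 ->
  measurable_fun setT F -> (forall x, (0 <= F x)%E) ->
  (\int[normal_prob c s]_x F x = \int[N01]_x F (s * x + c)%R)%E.
Proof.
move=> s0 mF F0.
have maff : measurable_fun setT (fun x : R => s * x + c).
  by apply: measurable_funD => //; exact: measurable_funM.
have mFa : measurable_fun setT (fun x : R => F (s * x + c)).
  exact: (measurableT_comp mF maff).
rewrite (ge0_integral_normal c s mF F0).
rewrite (ge0_integral_normal 0 1 mFa (fun x => F0 _)).
rewrite [LHS](ge0_integral_affine c s0); last 2 first.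
- apply: emeasurable_funM => //; apply/measurable_EFinP.
  exact: measurable_normal_pdf.
- by move=> x; rewrite mule_ge0// lee_fin normal_pdf_ge0.
rewrite -ge0_integralZl//.
- apply: eq_integral => x _.
  by rewrite muleCA -EFinM normal_pdf_affine.
- apply: emeasurable_funM; first exact: measurableT_comp.
  by apply/measurable_EFinP; apply: measurableT_comp => //; exact: measurable_normal_pdf.
- by move=> x _; rewrite mule_ge0// lee_fin normal_pdf_ge0.
Qed.

Lemma normal_sym (F : R -> \bar R) :
  measurable_fun setT F -> (forall x, (0 <= F x)%E) ->
  (\int[N01]_x F (- x)%R = \int[N01]_x F x)%E.
Proof.
move=> mF F0.
have E : normal_pdf (0 : R) (-1) = normal_pdf 0 1.
  apply/funext => x.
  by rewrite !normal_pdfE ?oppr_eq0 ?oner_eq0// /normal_peak /normal_fun sqrrN.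
transitivity (\int[N01]_x F (-1 * x + 0)%R)%E.
  by apply: eq_integral => x _; rewrite mulN1r addr0.
have n1 : (-1 : R) != 0 by rewrite oppr_eq0 oner_eq0.
rewrite -(normal_affine 0 n1 mF F0).
by rewrite (ge0_integral_normal 0 (-1) mF F0) (ge0_integral_normal 0 1 mF F0) E.
Qed.

(** Completing the square: the joint density of y and s x + t y, as the density of
    the sum times the conditional density of y given the sum. *)
Lemma normal_pdf_conv (s t r u y : R) : s != 0 -> r != 0 ->
  r ^+ 2 = s ^+ 2 + t ^+ 2 ->
  normal_pdf (t * y) s u * normal_pdf 0 1 y =
  normal_pdf 0 r u * normal_pdf (t * u / r ^+ 2) (s / r) y.
Proof.
move=> s0 r0 rE; rewrite !normal_pdfE ?oner_eq0 ?mulf_neq0 ?invr_eq0//.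
have s20 : 0 <= s ^+ 2 by rewrite sqr_ge0.
have r20 : 0 <= r ^+ 2 by rewrite sqr_ge0.
have sE : s ^+ 2 = r ^+ 2 - t ^+ 2 by rewrite rE addrK.
have pi0 := pi_gt0 R.
rewrite mulrACA [RHS]mulrACA; congr (_ * _).
  have peakE (a : R) : normal_peak a = (`|a| * Num.sqrt (pi *+ 2))^-1.
    by rewrite /normal_peak -mulrnAr sqrtrM ?sqr_ge0// sqrtr_sqr.
  rewrite !peakE normr1 mul1r normrM normfV.
  have : `|r| != 0 by rewrite normr_eq0.
  have : `|s| != 0 by rewrite normr_eq0.
  have : Num.sqrt (pi *+ 2 : R) != 0 by rewrite gt_eqF// sqrtr_gt0 mulrn_wgt0.
  move: (Num.sqrt _) => w w0 ns nr; field.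
  by rewrite w0 ns nr.
rewrite /normal_fun -!expRD; congr expR.
rewrite !subr0 expr1n expr_div_n.
have s2n : s ^+ 2 != 0 by rewrite sqrf_eq0.
have r2n : r ^+ 2 != 0 by rewrite sqrf_eq0.
move: s2n r2n rE {sE s20 r20 s0 r0}.
move: (s ^+ 2) (r ^+ 2) => S T S0 T0 TE.
have SE : S = T - t ^+ 2 by rewrite TE addrK.
rewrite SE in S0 *; field.
by rewrite T0 S0.
Qed.

(** Exchange the order of integration after a change of variables; the inner
    integral is then the one of a normal density. *)
Lemma normal_conv (s t r : R) (F : R -> \bar R) : r ^+ 2 = s ^+ 2 + t ^+ 2 ->
  measurable_fun setT F -> (forall x, (0 <= F x)%E) ->
  (\int[N01]_y \int[N01]_x F (s * x + t * y)%R = \int[N01]_x F (r * x)%R)%E.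
Proof.
move=> rE mF F0.
have mlin (a : R) : measurable_fun setT (fun x : R => a * x) by exact: measurable_funM.
(* [normal_pdf] is not a density for the standard deviation zero. *)
have [s0|s0] := eqVneq s 0.
  transitivity (\int[N01]_y F (t * y)%R)%E.
    apply: eq_integral => y _; rewrite s0.
    under eq_integral do rewrite mul0r add0r.
    by rewrite integral_cst// [X in (_ * X)%E](_ : _ = 1%E) ?mule1//; exact: probability_setT.
  have /eqP : r ^+ 2 = t ^+ 2 by rewrite rE s0 expr0n add0r.
  rewrite eqf_sqr => /orP[/eqP->//|/eqP->].
  rewrite -(normal_sym (F := fun x => F (t * x)%R))//; last exact: measurableT_comp.
  by apply: eq_integral => x _; rewrite mulrN mulNr.
have r20 : 0 < r ^+ 2 by rewrite rE ltr_pwDl ?sqr_ge0// exprn_even_gt0.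
have r0 : r != 0 by rewrite -sqrf_eq0 gt_eqF.
pose h (y u : R) := (F u * (normal_pdf (t * y) s u * normal_pdf 0 1 y)%:E)%E.
have mpdf : measurable_fun setT (fun z : R * R => normal_pdf (t * z.1) s z.2).
  have -> : (fun z : R * R => normal_pdf (t * z.1) s z.2) =
      (fun z => normal_pdf 0 s (z.2 - t * z.1)).
    apply/funext => z; rewrite !normal_pdfE// /normal_fun subr0//.
  apply: measurableT_comp; first exact: measurable_normal_pdf.
  apply: measurable_funB; first exact: measurable_snd.
  by apply: measurable_funM => //; exact: measurable_fst.
pose G (z : measurableTypeR R * measurableTypeR R) :=
  (F z.2 * (normal_pdf (t * z.1) s z.2)%:E)%E.
have mG : measurable_fun setT G.
  apply: emeasurable_funM; last exact/measurable_EFinP.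
  by apply: measurableT_comp => //; exact: measurable_snd.
have G0 z : (0 <= G z)%E by rewrite mule_ge0// lee_fin normal_pdf_ge0.
transitivity (\int[leb]_y \int[leb]_u h y u)%E.
  transitivity (\int[N01]_y \int[leb]_u (F u * (normal_pdf (t * y) s u)%:E))%E.
    apply: eq_integral => y _.
    rewrite -(ge0_integral_normal (t * y) s mF F0).
    by rewrite (normal_affine (t * y) s0 mF F0).
  rewrite [LHS]ge0_integral_normal; last 2 first.
  - exact: (measurable_fun_fubini_tonelli_F (m2 := leb) G mG G0).
  - by move=> y; apply: integral_ge0 => u _; rewrite mule_ge0// lee_fin normal_pdf_ge0.
  apply: eq_integral => y _; rewrite muleC -ge0_integralZl//.
  - by apply: eq_integral => u _; rewrite /h EFinM [RHS]muleA [RHS]muleC.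
  - apply: emeasurable_funM => //; apply/measurable_EFinP; exact: measurable_normal_pdf.
  - by move=> u _; rewrite mule_ge0// lee_fin normal_pdf_ge0.
  - by rewrite lee_fin normal_pdf_ge0.
pose H (z : measurableTypeR R * measurableTypeR R) := h z.1 z.2.
have mH : measurable_fun setT H.
  rewrite /H /h; apply: emeasurable_funM.
    by apply: measurableT_comp => //; exact: measurable_snd.
  apply/measurable_EFinP; apply: measurable_funM => //.
  by apply: measurableT_comp; [exact: measurable_normal_pdf|exact: measurable_fst].
have H0 z : (0 <= H z)%E.
  by rewrite /H /h mule_ge0// lee_fin mulr_ge0// normal_pdf_ge0.
rewrite (fubini_tonelli (m1 := leb) (m2 := leb) H mH H0) /H/=.
transitivity (\int[normal_prob 0 r]_u F u)%E; last first.
  rewrite (normal_affine 0 r0 mF F0).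
  by apply: eq_integral => x _; rewrite addr0.
rewrite (ge0_integral_normal 0 r mF F0); apply: eq_integral => u _.
rewrite /h ge0_integralZl//; last 2 first.
- apply/measurable_EFinP; apply: measurable_funM; last exact: measurable_normal_pdf.
  exact: (measurableT_comp mpdf (pair2_measurable u)).
- by move=> y _; rewrite lee_fin mulr_ge0// normal_pdf_ge0.
congr (_ * _)%E.
transitivity (\int[leb]_y ((normal_pdf 0 r u)%:E * (normal_pdf (t * u / r ^+ 2) (s / r) y)%:E))%E.
  apply: eq_integral => y _; rewrite -EFinM; congr EFin.
  exact: normal_pdf_conv.
rewrite integralZl//; last exact: integrable_normal_pdf.
by rewrite integral_normal_pdf mule1.
Qed.

End normal.

(** * Gaussian vectors *)

Section same_law.
Context d1 d2 (T1 : measurableType d1) (T2 : measurableType d2) (R : realType).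
Variables (P1 : probability T1 R) (P2 : probability T2 R).
Variables (X1 : T1 -> R) (X2 : T2 -> R).
Hypotheses (mX1 : measurable_fun setT X1) (mX2 : measurable_fun setT X2).
Hypothesis same : forall A, measurable A -> P1 (X1 @^-1` A) = P2 (X2 @^-1` A).

Lemma same_law_ge0_integral (f : R -> \bar R) : measurable_fun setT f ->
  (forall x, (0 <= f x)%E) ->
  (\int[P1]_x f (X1 x) = \int[P2]_x f (X2 x))%E.
Proof.
move=> mf f0.
have := ge0_integral_law P1 mX1 measurableT mf f0; rewrite preimage_setT => <-.
have := ge0_integral_law P2 mX2 measurableT mf f0; rewrite preimage_setT => <-.
by apply: eq_measure_integral => A mA _; exact: same.
Qed.

Lemma same_law_integrable (f : R -> R) : measurable_fun setT f ->
  P1.-integrable setT (EFin \o (f \o X1)) ->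
  P2.-integrable setT (EFin \o (f \o X2)).
Proof.
move=> mf /integrableP[_ fX1]; apply/integrableP; split.
  by apply/measurable_EFinP; exact: measurableT_comp.
rewrite -(@same_law_ge0_integral (fun x => `|(f x)%:E|%E))//.
by apply: measurableT_comp => //; apply/measurable_EFinP.
Qed.

Lemma same_law_Rintegral (f : R -> R) : measurable_fun setT f ->
  P1.-integrable setT (EFin \o (f \o X1)) ->
  (\int[P1]_x f (X1 x) = \int[P2]_x f (X2 x))%R.
Proof.
move=> mf iX1; have iX2 := same_law_integrable mf iX1.
have mEf : measurable_fun setT (EFin \o f) by exact/measurable_EFinP.
have e1 := integral_pushforward mX1 mEf iX1 measurableT.
have e2 := integral_pushforward mX2 mEf iX2 measurableT.
rewrite /Rintegral; congr fine; apply: etrans (etrans (esym e1) _) e2.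
apply: (eq_measure_integral (law P2 mX2) (m1 := law P1 mX1)) => A mA _.
exact: same.
Qed.

End same_law.

Section normal_moments.
Context (R : realType).
Local Notation N01 := (normal_prob (0 : R) 1).
Local Notation intN f := (N01.-integrable setT (EFin \o f)).

Lemma measurable_affine (s c : R) : measurable_fun setT (fun y : R => s * y + c).
Proof. by apply: measurable_funD => //; exact: measurable_funM. Qed.

Lemma normal_sym_set (A : set R) : measurable A ->
  N01 A = N01 ((fun y : R => - y) @^-1` A).
Proof.
move=> mA.
have mindic : measurable_fun setT (fun y : R => (\1_A y)%:E : \bar R).
  by apply/measurable_EFinP; exact: measurable_indic.
have ind0 y : (0 <= (\1_A y)%:E :> \bar R)%E by rewrite lee_fin.
have := normal_sym mindic ind0.
rewrite [X in _ = X -> _]integral_indic// setIT => <-.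
have mp : measurable ((fun y : R => - y) @^-1` A).
  by rewrite -[X in measurable X]setTI; exact: oppr_measurable.
by rewrite -[X in _ = N01 X]setIT -integral_indic.
Qed.

Lemma normal_mean0 : intN (fun y : R => y) -> (\int[N01]_y y = 0)%R.
Proof.
move=> iy.
have E := same_law_Rintegral (P1 := N01) (P2 := N01) (X1 := idfun)
  (X2 := fun y => - y) (@measurable_id _ _ _) (@oppr_measurable _ _)
  normal_sym_set (f := idfun) (@measurable_id _ _ _) iy.
have : (\int[N01]_y (- y) = -1 * \int[N01]_y y)%R.
  by rewrite -RintegralZl//; apply: eq_Rintegral => y _; rewrite mulN1r.
rewrite /= in E; rewrite -E; lra.
Qed.

(** Writing the law as an affine image of the standard normal law treats the
    degenerate and the nondegenerate case together. *)
Lemma is_gaussian_affine d (T : measurableType d) (P : probability T R)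
    (X : T -> R) : measurable_fun setT X -> is_gaussian (pushforward P X) ->
  exists s c : R, forall A, measurable A ->
    P (X @^-1` A) = N01 ((fun y => s * y + c) @^-1` A).
Proof.
move=> mX [[c hc]|[c [s [s0 hs]]]].
  exists 0, c => A mA; rewrite [LHS](hc A mA) diracE.
  have [/set_mem Ac|/negP Ac] := boolP (c \in A).
    rewrite (_ : _ @^-1` _ = setT) ?probability_setT//.
    by apply/seteqP; split => // y _ /=; rewrite mul0r add0r.
  rewrite (_ : _ @^-1` _ = set0) ?measure0//.
  by apply/seteqP; split => // y /=; rewrite mul0r add0r => cA; apply: Ac; rewrite inE.
exists s, c => A mA; rewrite [LHS](hs A mA).
have mindic : measurable_fun setT (fun y : R => (\1_A y)%:E : \bar R).
  by apply/measurable_EFinP; exact: measurable_indic.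
have ind0 y : (0 <= (\1_A y)%:E :> \bar R)%E by rewrite lee_fin.
have := normal_affine c s0 mindic ind0.
rewrite integral_indic// setIT => ->.
have mp : measurable ((fun y : R => s * y + c) @^-1` A).
  by rewrite -[X in measurable X]setTI; exact: measurable_affine.
by rewrite -[X in N01 X]setIT -integral_indic.
Qed.

End normal_moments.

Section gaussian_vector.
Context (R : realType) (m : nat) (rho : R) (mu : probability (prodspace 'I_m R) R).
Hypothesis hmu : gaussian_law rho mu.
Local Notation N01 := (normal_prob (0 : R) 1).
Local Notation intmu f := (mu.-integrable setT (EFin \o f)).
Local Notation coord k := (fun x : prodspace 'I_m R => x k).

Let mcoord k : measurable_fun setT (coord k).
Proof. exact: measurable_coord. Qed.

Let expect0 k : (\int[mu]_x (x k)%:E = 0)%E.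
Proof. by have [_ /(_ k) + _ _] := hmu; rewrite unlock. Qed.

Lemma gaussian_cov (k l : 'I_m) :
  (\int[mu]_x (x k * x l)%:E = (if k == l then 1 else rho)%:E)%E.
Proof.
have [_ hE hV hC] := hmu.
have covE : (\int[mu]_x (x k * x l)%:E = covariance mu (coord k) (coord l))%E.
  rewrite unlock !hE unlock; apply: eq_integral => x _.
  by congr EFin; rewrite -[RHS]/((x k - 0) * (x l - 0)) !subr0.
rewrite covE; have [<-|kl] := eqVneq k l; first exact: hV.
exact: hC.
Qed.

Let int_sq k : intmu (fun x => x k * x k).
Proof.
apply/integrableP; split.
  by apply/measurable_EFinP; exact: measurable_funM.
under eq_integral do rewrite /= ger0_norm -?expr2 ?sqr_ge0// expr2.
by rewrite gaussian_cov ltry.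
Qed.

Let int_prod k l : intmu (fun x => x k * x l).
Proof.
apply: (@le_integrable _ _ _ mu setT measurableT _
  (EFin \o (fun x => x k * x k + x l * x l))).
- by apply/measurable_EFinP; exact: measurable_funM.
- move=> x _ /=; rewrite lee_fin [leRHS]ger0_norm; last first.
    by rewrite -!expr2 addr_ge0 ?sqr_ge0.
  by rewrite ler_norml; apply/andP; split; nra.
- by apply: (integrableD measurableT (int_sq k) (int_sq l)).
Qed.

Let int_coord k : intmu (coord k).
Proof.
apply: (@le_integrable _ _ _ mu setT measurableT _
  (EFin \o (fun x => 1 + x k * x k))).
- exact/measurable_EFinP.
- move=> x _ /=; rewrite lee_fin [leRHS]ger0_norm; last first.
    by rewrite -expr2 addr_ge0 ?sqr_ge0.
  by rewrite ler_norml; apply/andP; split; nra.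
- apply: (integrableD measurableT (f := cst 1%:E) _ (int_sq k)).
  exact: finite_measure_integrable_cst.
Qed.

Lemma Rintegral_sum d (T : measurableType d) (P : probability T R)
    (I : finType) (f : I -> T -> R) :
  (forall i, P.-integrable setT (EFin \o f i)) ->
  P.-integrable setT (EFin \o (fun x => \sum_i f i x)) /\
  (\int[P]_x (\sum_i f i x) = \sum_i \int[P]_x f i x)%R.
Proof.
move=> hf.
have E : EFin \o (fun x => \sum_i f i x) = (fun x => \sum_i (EFin \o f i) x)%E.
  by apply/funext => x /=; rewrite sumEFin.
split; first by rewrite E; exact: integrable_sum.
rewrite /Rintegral sum_fine => [|i _]; last exact: (integrable_fin_num measurableT (hf i)).
congr fine; rewrite -integral_sum//.
by apply: eq_integral => x _; rewrite sumEFin.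
Qed.

Definition cov_form (b b' : 'I_m -> R) : R :=
  \sum_k \sum_l b k * b' l * (if k == l then 1 else rho).

Lemma linformM (b b' : 'I_m -> R) (x : prodspace 'I_m R) :
  linform b x * linform b' x =
  \sum_k \sum_l b k * b' l * (x k * x l).
Proof.
rewrite /linform mulr_suml; apply: eq_bigr => k _; rewrite mulr_sumr.
by apply: eq_bigr => l _; rewrite mulrACA.
Qed.

Lemma gaussian_linform_cov (b b' : 'I_m -> R) :
  intmu (fun x => linform b x * linform b' x) /\
  (\int[mu]_x (linform b x * linform b' x) = cov_form b b')%R.
Proof.
have -> : (fun x : prodspace 'I_m R => linform b x * linform b' x) =
  (fun x => \sum_k \sum_l b k * b' l * (x k * x l)).
  by apply/funext => x; exact: linformM.
have h1 k l : intmu (fun x => b k * b' l * (x k * x l)).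
  exact: (integrableZl measurableT (b k * b' l) (int_prod k l)).
have h2 k := Rintegral_sum (h1 k).
have [h3 ->] := Rintegral_sum (fun k => (h2 k).1).
split => //; apply: eq_bigr => k _; rewrite (h2 k).2; apply: eq_bigr => l _.
by rewrite RintegralZl// /Rintegral gaussian_cov.
Qed.

Lemma gaussian_linform_mean (b : 'I_m -> R) :
  intmu (linform b) /\ (\int[mu]_x linform b x = 0)%R.
Proof.
have h k : intmu (fun x => b k * x k) by exact: (integrableZl measurableT (b k) (int_coord k)).
have [h1 h2] := Rintegral_sum h; split => //.
rewrite /linform h2 big1// => k _.
by rewrite RintegralZl// /Rintegral expect0 mulr0.
Qed.

Lemma linform_normal (b : 'I_m -> R) : exists s c : R, forall A, measurable A ->
  mu (linform b @^-1` A) = N01 ((fun y => s * y + c) @^-1` A).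
Proof.
apply: is_gaussian_affine; first exact: measurable_linform.
by have [/(_ b) h _ _ _] := hmu.
Qed.

Hypothesis m0 : (0 < m)%N.

(** The laws of the linear forms are determined by their variances. That the
    standard normal law has a finite variance [v] is read off from a coordinate
    of the vector, which has variance one and is an affine image of it. *)
Lemma normal_variance : exists2 v : R, 0 < v &
  forall b, exists2 s, s ^+ 2 * v = cov_form b b &
    forall A, measurable A ->
      mu (linform b @^-1` A) = N01 ((fun y => s * y) @^-1` A).
Proof.
pose k0 := Ordinal m0; pose b0 k : R := (k == k0)%:R.
have sq : measurable_fun setT (fun y : R => y * y) by exact: measurable_funM.
have b0E : cov_form b0 b0 = 1.
  rewrite /cov_form (bigD1 k0)//= [X in _ + X]big1 ?addr0; last first.
    by move=> k /negbTE kk; rewrite big1// => l _; rewrite /b0 kk !mul0r.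
  rewrite (bigD1 k0)//= [X in _ + X]big1 ?addr0; last first.
    by move=> l /negbTE ll; rewrite /b0 ll mulr0 mul0r.
  by rewrite /b0 !eqxx !mul1r.
have [s0 [c0 h0]] := linform_normal b0.
have m1 (b : 'I_m -> R) := measurable_linform b.
have [i1 e1] := gaussian_linform_mean b0.
have [i2 e2] := gaussian_linform_cov b0 b0.
have j1 := same_law_integrable (P1 := mu) (P2 := N01) (m1 b0) (measurable_affine s0 c0) h0 (f := idfun)
  (@measurable_id _ _ _) i1.
have j2 := same_law_integrable (P1 := mu) (P2 := N01) (m1 b0) (measurable_affine s0 c0) h0 sq i2.
have f1 := same_law_Rintegral (P1 := mu) (P2 := N01) (m1 b0) (measurable_affine s0 c0) h0 (f := idfun)
  (@measurable_id _ _ _) i1.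
have f2 := same_law_Rintegral (P1 := mu) (P2 := N01) (m1 b0) (measurable_affine s0 c0) h0 sq i2.
rewrite /= in j1 j2 f1 f2.
have cstint (c : R) : N01.-integrable setT (EFin \o (fun=> c)) by exact: finite_measure_integrable_cst.
have cstE (c : R) : (\int[N01]_y c = c)%R.
  rewrite Rintegral_cst// [X in fine X](_ : _ = 1%E) ?mulr1//.
  exact: probability_setT.
have s00 : s0 != 0.
  apply/eqP => s00.
  have c00 : c0 = 0.
    rewrite -e1 f1 -[LHS]cstE; apply: eq_Rintegral => y _.
    by rewrite s00 mul0r add0r.
  suff /eqP : (1 : R) = 0 by rewrite oner_eq0.
  rewrite -[LHS]b0E -e2 f2 -[RHS]cstE; apply: eq_Rintegral => y _.
  by rewrite s00 c00 mul0r add0r mul0r.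
have iy : N01.-integrable setT (EFin \o (fun y : R => y)).
  have := integrableZl measurableT s0^-1
    (integrableB measurableT j1 (cstint c0)).
  apply: eq_integrable => // y _ /=.
  by rewrite -EFinB -EFinM addrK mulrA mulVf// mul1r.
have meanE s c : (\int[N01]_y (s * y + c) = c)%R.
  rewrite RintegralD// ?cstE; last exact: (integrableZl measurableT s iy).
  by rewrite RintegralZl// normal_mean0// mulr0 add0r.
have c00 : c0 = 0 by rewrite -(meanE s0 c0) -f1 e1.
have iyy : N01.-integrable setT (EFin \o (fun y : R => y * y)).
  have := integrableZl measurableT (s0^-1 * s0^-1) j2.
  apply: eq_integrable => // y _ /=; rewrite -EFinM c00 !addr0.
  by congr EFin; field.
pose v : R := (\int[N01]_y (y * y))%R.
have varE s : (\int[N01]_y ((s * y) * (s * y)) = s ^+ 2 * v)%R.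
  rewrite -RintegralZl//; apply: eq_Rintegral => y _.
  by rewrite mulrACA.
exists v.
  have s0v : s0 ^+ 2 * v = 1.
    rewrite -varE; apply: etrans (etrans e2 b0E); rewrite f2.
    apply: eq_Rintegral => y _.
    by rewrite c00 addr0.
  rewrite -(pmulr_rgt0 v (x := s0 ^+ 2)); last by rewrite exprn_even_gt0.
  by rewrite s0v.
move=> b; have [s [c hb]] := linform_normal b.
have [k1 g1] := gaussian_linform_mean b.
have [k2 g2] := gaussian_linform_cov b b.
have l1 := same_law_Rintegral (P1 := mu) (P2 := N01) (m1 b) (measurable_affine s c) hb (f := idfun)
  (@measurable_id _ _ _) k1.
have l2 := same_law_Rintegral (P1 := mu) (P2 := N01) (m1 b) (measurable_affine s c) hb sq k2.
rewrite /= in l1 l2.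
have cc : c = 0 by rewrite -(meanE s c) -l1 g1.
exists s.
  rewrite -g2 l2 -varE; apply: eq_Rintegral => y _.
  by rewrite cc addr0.
move=> A mA; rewrite hb//; congr (N01 _).
by apply/seteqP; split => y /=; rewrite cc addr0.
Qed.

End gaussian_vector.

(** * First entry of an edge given the aggregate of the others *)

Lemma big_later (m : nat) (R : Type) (idx : R) (op : Monoid.com_law idx)
    (F : 'I_m -> R) :
  \big[op/idx]_(k : later m) F (val k) = \big[op/idx]_(k < m | (0 < k)%N) F k.
Proof.
rewrite (reindex_omap (val : later m -> 'I_m) insub)/=; last first.
  by move=> i i0; rewrite insubT.
apply: eq_bigl => k; rewrite (valP k) valK/= eqxx//.
Qed.

Lemma measurable_bigmax (R : realType) (I : finType) d (T : measurableType d)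
    (f : I -> T -> R) : (forall i, measurable_fun setT (f i)) ->
  measurable_fun setT (fun x => \big[Num.max/0]_i f i x).
Proof.
move=> mf; elim: (index_enum _) => [|i r IH].
  have -> : (fun x => \big[Num.max/0]_(i <- [::]) f i x) = (fun=> 0).
    by apply/funext => x; rewrite big_nil.
  exact: measurable_cst.
have -> : (fun x => \big[Num.max/0]_(i <- i :: r) f i x) =
    f i \max (fun x => \big[Num.max/0]_(i <- r) f i x).
  by apply/funext => x; rewrite big_cons.
exact: measurable_maxr.
Qed.

Definition later_part (R : Type) (m : nat) (x : 'I_m -> R) : later m -> R :=
  fun k => x (val k).

Lemma measurable_later_part (R : realType) (m : nat) :
  measurable_fun setT (@later_part R m : prodspace 'I_m R -> prodspace (later m) R).
Proof.
by apply: measurable_fun_prodspace => k; exact: (measurable_coord (val k)).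
Qed.

(** The aggregate of the later entries is sufficient for the first one. *)
Definition first_given_aggregate (R : realType) (m : nat) (hm : (3 <= m)%N)
    (mu : probability (prodspace 'I_m R) R)
    (agg : prodspace (later m) R -> R) (kappa : R -> set R -> R) : Prop :=
  [/\ forall B, measurable B -> measurable_fun setT (kappa ^~ B),
      forall y B, measurable B -> 0 <= kappa y B <= 1 &
      forall (B : set R) (C : set (prodspace (later m) R)),
        measurable B -> measurable C ->
        mu [set x | B (x (first hm)) /\ C (later_part x)] =
        (\int[mu]_(x in [set x | C (later_part x)])
           (kappa (agg (later_part x)) B)%:E)%E].

Section gaussian_conditional.
Context (R : realType) (m : nat) (hm : (3 <= m)%N) (rho : R).
Variable mu : probability (prodspace 'I_m R) R.
Hypotheses (hmu : gaussian_law rho mu) (rho01 : 0 <= rho <= 1).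
Local Notation f1 := (first hm).
Local Notation N01 := (normal_prob (0 : R) 1).

(* The coefficient that makes x_1 - c (x_2 + ... + x_m) uncorrelated with each
   later entry: rho = c (1 + (m - 2) rho). *)
Let c : R := rho / (1 + (m%:R - 2) * rho).

Let c_eq : c * (1 + (m%:R - 2) * rho) = rho.
Proof.
rewrite /c divfK// gt_eqF//.
have m3 : 3 <= m%:R :> R by rewrite ler_nat.
by have /andP[r0 r1] := rho01; rewrite ltr_pwDl// mulr_ge0// subr_ge0; lra.
Qed.

(* A linear form [b] is split into a multiple of that residual [u] and a form
   [h b] in the later entries. *)
Let u (k : 'I_m) : R := if k == f1 then 1 else - c.

Let h (b : 'I_m -> R) (k : 'I_m) : R := if k == f1 then 0 else b k + b f1 * c.

Let b_split b k : b k = b f1 * u k + h b k.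
Proof. by rewrite /u /h; case: eqVneq => [->|_]; [ring|ring]. Qed.

Lemma linform_split (b : 'I_m -> R) (x : prodspace 'I_m R) :
  linform b x = b f1 * linform u x + linform (h b) x.
Proof.
rewrite /linform mulr_sumr -big_split/=; apply: eq_bigr => k _.
by rewrite {1}b_split; ring.
Qed.

Lemma cov_formC (b b' : 'I_m -> R) : cov_form rho b b' = cov_form rho b' b.
Proof.
rewrite /cov_form exchange_big; apply: eq_bigr => k _; apply: eq_bigr => l _.
by rewrite eq_sym (mulrC (b l)).
Qed.

Lemma cov_formDl (a : R) (b b' b'' : 'I_m -> R) :
  cov_form rho (fun k : 'I_m => a * b k + b' k) b'' =
  a * cov_form rho b b'' + cov_form rho b' b''.
Proof.
rewrite /cov_form mulr_sumr -big_split/=; apply: eq_bigr => k _.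
rewrite mulr_sumr -big_split/=; apply: eq_bigr => l _; ring.
Qed.

Lemma cov_residual (b : 'I_m -> R) : cov_form rho u (h b) = 0.
Proof.
rewrite /cov_form exchange_big big1// => l _.
transitivity (h b l * \sum_k u k * (if k == l then 1 else rho)).
  by rewrite mulr_sumr; apply: eq_bigr => k _; ring.
have [->|lf] := eqVneq l f1; first by rewrite /h eqxx mul0r.
suff -> : \sum_k u k * (if k == l then 1 else rho) = 0 by rewrite mulr0.
have cnt : \sum_(k < m | (k != f1) && (k != l)) rho = (m%:R - 2) * rho.
  have : \sum_(k < m) rho = m%:R * rho by rewrite sumr_const card_ord mulr_natl.
  by rewrite (bigD1 f1)//= (bigD1 l)//=; lra.
rewrite (bigD1 f1)//= eq_sym (negbTE lf) (bigD1 l)//= eqxx {1 2}/u eqxx (negbTE lf).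
rewrite (eq_bigr (fun=> - c * rho)) => [|k /andP[kf kl]]; last first.
  by rewrite /u (negbTE kf) (negbTE kl).
rewrite -mulr_sumr cnt -[in X in X + _]c_eq; ring.
Qed.

Lemma cov_split (b : 'I_m -> R) : cov_form rho b b =
  b f1 ^+ 2 * cov_form rho u u + cov_form rho (h b) (h b).
Proof.
have -> : cov_form rho b b = cov_form rho (fun k => b f1 * u k + h b k)
    (fun k => b f1 * u k + h b k).
  by congr (cov_form _ _ _); apply/funext => k; exact: b_split.
rewrite cov_formDl cov_formC cov_formDl [X in _ + X]cov_formC cov_formDl.
by rewrite cov_residual (cov_formC _ u) cov_residual; ring.
Qed.

Definition later_sum (x : prodspace 'I_m R) : R := \sum_(k : later m) x (val k).

Let linform_u x : linform u x = x f1 - c * later_sum x.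
Proof.
rewrite /later_sum (big_later _ x) /linform (bigD1 f1)//= {1}/u eqxx mul1r.
congr (_ + _); rewrite mulr_sumr -sumrN; apply: eq_big => k.
  by rewrite lt0n -val_eqE.
by move=> kf; rewrite /u (negbTE kf) mulNr.
Qed.

(** The later entries of one copy of the vector, completed by a first entry whose
    residual comes from an independent copy. *)
Definition resample (z : prodspace 'I_m R * prodspace 'I_m R) : prodspace 'I_m R :=
  fun k => if k == f1 then linform u z.2 + c * later_sum z.1 else z.1 k.

Lemma measurable_later_sum : measurable_fun setT later_sum.
Proof. by apply: measurable_sum => k; exact: measurable_coord. Qed.

Lemma measurable_resample : measurable_fun setT resample.
Proof.
apply: measurable_fun_prodspace => k; rewrite /resample; case: (k == f1).
  apply: measurable_funD.
    by apply: measurableT_comp; [exact: measurable_linform|exact: measurable_snd].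
  apply: measurable_funM => //.
  by apply: measurableT_comp; [exact: measurable_later_sum|exact: measurable_fst].
exact: (measurableT_comp (measurable_coord k) measurable_fst).
Qed.

Lemma linform_resample (b : 'I_m -> R) z :
  linform b (resample z) = b f1 * linform u z.2 + linform (h b) z.1.
Proof.
rewrite linform_split; congr (_ * _ + _).
  rewrite linform_u {1}/resample eqxx.
  suff -> : later_sum (resample z) = later_sum z.1 by rewrite addrK.
  apply: eq_bigr => k _; rewrite /resample; case: eqVneq => // kf.
  by have := valP k; rewrite kf.
apply: eq_bigr => k _; rewrite /h /resample; case: eqVneq => //.
by rewrite !mul0r.
Qed.

(** Independence of the residual and the later entries. Every linear form of the
    resampled vector is a sum of two independent normal variables whose
    variances add up to the one of the original form. *)
Lemma mu_resample A : measurable A ->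
  mu A = (mu \x mu)%E (resample @^-1` A).
Proof.
apply: (cramer_wold (nu := law (mu \x mu)%E measurable_resample)) => {A} b A mA.
have [v v0 hv] := normal_variance hmu (ltnW (ltnW hm)).
have [s sE hs] := hv u; have [t tE ht] := hv (h b); have [r rE hr] := hv b.
have rst : r ^+ 2 = (b f1 * s) ^+ 2 + t ^+ 2.
  apply: (mulIf (lt0r_neq0 v0)); rewrite rE cov_split -sE -tE; ring.
pose F (y : R) : \bar R := (\1_A y)%:E.
have mF : measurable_fun setT F.
  by apply/measurable_EFinP; exact: measurable_indic.
have F0 y : (0 <= F y)%E by rewrite lee_fin.
pose G (y : R) : \bar R := (\int[N01]_w F (b f1 * s * w + y)%R)%E.
have mG : measurable_fun setT G.
  pose H (z : R * R) := F (b f1 * s * z.2 + z.1)%R.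
  have mH : measurable_fun setT H.
    apply: (measurableT_comp mF); apply: measurable_funD; last exact: measurable_fst.
    by apply: measurable_funM => //; exact: measurable_snd.
  exact: (measurable_fun_fubini_tonelli_F (m2 := N01) H mH (fun z => F0 _)).
have G0 y : (0 <= G y)%E by apply: integral_ge0 => w _; exact: F0.
have NE (B : set R) : measurable B -> N01 B = (\int[N01]_y (\1_B y)%:E)%E.
  by move=> mB; rewrite integral_indic// setIT.
have mpre (B : set R) (f : R -> R) : measurable B -> measurable_fun setT f ->
    measurable (f @^-1` B).
  by move=> mB mf; rewrite -[X in measurable X]setTI; exact: mf.
transitivity (\int[N01]_y F (r * y)%R)%E.
  by rewrite hr// NE//; apply: mpre => //; exact: measurable_funM.
rewrite -(normal_conv rst mF F0).
transitivity (\int[N01]_y G (t * y)%R)%E; first by [].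
rewrite -(same_law_ge0_integral (P1 := mu) (P2 := N01) (measurable_linform (h b)) _ ht mG G0).
  apply: eq_integral => x _.
  have maff : measurable_fun setT (fun w : R => b f1 * w + linform (h b) x).
    exact: measurable_affine.
  transitivity (mu (linform u @^-1` ((fun w => b f1 * w + linform (h b) x) @^-1` A))).
    rewrite hs; last exact: mpre.
    rewrite NE; last first.
      by apply: (mpre _ _ (mpre _ _ mA maff)); exact: measurable_funM.
    apply: eq_integral => w _; rewrite /F !indicE; congr (nat_of_bool _)%:R%:E.
    by apply/idP/idP; rewrite !inE/= mulrA.
  congr (mu _); apply/seteqP; split => x'; rewrite /xsection/= inE/=;
    by rewrite linform_resample.
exact: measurable_funM.
Qed.

(** The resampled vector has a first entry that depends on the later ones through
    their sum only, its residual being independent of them. *)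
Lemma gaussian_first_given_aggregate : exists kappa,
  first_given_aggregate hm mu (fun z => \sum_k z k) kappa.
Proof.
pose Bset B (y : R) := [set x : prodspace 'I_m R | B (linform u x + c * y)].
have mf : measurable_fun setT
    (fun z : R * prodspace 'I_m R => linform u z.2 + c * z.1).
  apply: measurable_funD.
    exact: (measurableT_comp (measurable_linform u) measurable_snd).
  by apply: measurable_funM => //; exact: measurable_fst.
have mB2 B : measurable B ->
    measurable [set z : R * prodspace 'I_m R | B (linform u z.2 + c * z.1)].
  by move=> mB; rewrite -[X in measurable X]setTI; exact: mf.
have BE (B : set R) y :
    xsection [set z : R * prodspace 'I_m R | B (linform u z.2 + c * z.1)] y = Bset B y.
  by apply/seteqP; split => x; rewrite /xsection/= inE.
have mBset (B : set R) y : measurable B -> measurable (Bset B y).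
  by move=> mB; rewrite -BE; apply: measurable_xsection; exact: mB2.
exists (fun y B => fine (mu (Bset B y))); split.
- move=> B mB; apply: (measurableT_comp (f := fine)) => //.
  rewrite (_ : (fun y => _) = (fun y => mu (xsection
    [set z : R * prodspace 'I_m R | B (linform u z.2 + c * z.1)] y))).
    by apply: measurable_fun_xsection; exact: mB2.
  by apply/funext => y; rewrite BE.
- move=> y B mB; rewrite fine_ge0//= -lee_fin fineK ?fin_num_measure ?probability_le1//;
    exact: mBset.
move=> B C mB mC.
have mC' : measurable [set x : prodspace 'I_m R | C (later_part x)].
  by rewrite -[X in measurable X]setTI; exact: measurable_later_part.
rewrite mu_resample; last first.
  apply: measurableI => //.
  by rewrite -[X in measurable X]setTI; exact: measurable_coord.
rewrite integral_setE; apply: eq_integral => x _ /=.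
have laterE x' : later_part (resample (x, x')) = later_part x.
  apply/funext => k; rewrite /later_part /resample; case: eqVneq => // kf.
  by have := valP k; rewrite kf.
rewrite indicE fineK ?fin_num_measure//; last exact: mBset.
have [/set_mem Cx|/negP Cx] := boolP (x \in _).
  rewrite mul1e; congr (mu _); apply/seteqP; split => x'; rewrite /xsection/= inE/=.
    by rewrite {1}/resample eqxx => -[].
  by move=> Bx; split; [rewrite /resample eqxx|rewrite laterE].
rewrite mul0e (_ : xsection _ _ = set0) ?measure0//.
apply/seteqP; split => // x'; rewrite /xsection/= inE/= => -[_].
by rewrite laterE => Cx'; apply: Cx; rewrite inE.
Qed.

End gaussian_conditional.

Section independent_of_rest.
Context d (T : measurableType d) (R : realType) (nu : probability T R)
  (I : finType) (Z : I -> {mfun T >-> bool}) (i0 : I).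
Hypothesis indep : mutually_independent nu Z.

(** The family without [Z i0], whose entry is frozen to a constant so that the
    index type stays the same. *)
Definition all_but (w : T) : {ffun I -> bool} :=
  [ffun i => if i == i0 then false else Z i w].

Let mZ i (b : set bool) : measurable (Z i @^-1` b).
Proof. by rewrite -[X in measurable X]setTI; exact: measurable_funPT. Qed.

Let cell (b : set bool) (v : {ffun I -> bool}) :=
  [set w | forall i, (if i == i0 then b else [set v i]) (Z i w)].

Let cellE (b : set bool) (v : {ffun I -> bool}) : v i0 = false ->
  cell b v = (Z i0 @^-1` b) `&` (all_but @^-1` [set v]).
Proof.
move=> v0; apply/seteqP; split => w /=.
  move=> h; split; first by have := h i0; rewrite eqxx.
  apply/ffunP => i; rewrite ffunE; have := h i.
  by case: eqVneq => [->|_ ->].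
move=> [bw vw] i; case: eqVneq => [->//|ii] /=.
by rewrite -vw ffunE (negbTE ii).
Qed.

Lemma all_but_cell (b : set bool) (v : {ffun I -> bool}) :
  nu (Z i0 @^-1` b `&` all_but @^-1` [set v]) =
  (nu (Z i0 @^-1` b) * nu (all_but @^-1` [set v]))%E.
Proof.
have [v0|v0] := boolP (v i0).
  have -> : all_but @^-1` [set v] = set0.
    by apply/seteqP; split => // w /= vw; move: v0; rewrite -vw ffunE eqxx.
  by rewrite setI0 measure0 mule0.
have cE b' := cellE b' (negbTE v0).
have P b' : nu (cell b' v) =
    (nu (Z i0 @^-1` b') * (\prod_(i | i != i0) fine (nu (Z i @^-1` [set v i])))%:E)%E.
  rewrite /cell (indep (B := fun i => if i == i0 then b' else [set v i]))//.
  rewrite (bigD1 i0)//= eqxx EFinM fineK ?fin_num_measure//.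
  congr (_ * _%:E)%E; apply: eq_bigr => i ii; by rewrite (negbTE ii).
rewrite -cE P; congr (_ * _)%E.
have := P setT; rewrite cE preimage_setT setTI => ->.
by rewrite probability_setT mul1e.
Qed.

Lemma measurable_all_but (v : {ffun I -> bool}) : measurable (all_but @^-1` [set v]).
Proof.
have [v0|v0] := boolP (v i0).
  rewrite (_ : _ @^-1` _ = set0)//.
  by apply/seteqP; split => // w /= vw; move: v0; rewrite -vw ffunE eqxx.
have := cellE setT (negbTE v0); rewrite preimage_setT setTI => <-.
rewrite (_ : cell _ _ = \bigcap_(i in [set: I]) (Z i @^-1` (if i == i0 then setT else [set v i]))).
  by apply: fin_bigcap_measurable => // i _; exact: mZ.
by apply/seteqP; split => w /= h i => [_|]; apply: h.
Qed.

(** The family without [Z i0] takes finitely many values, and each of them is a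
    product event. *)
Lemma independent_all_but (b : set bool) (D : set {ffun I -> bool}) :
  measurable (all_but @^-1` D) /\
  nu (Z i0 @^-1` b `&` all_but @^-1` D) =
  (nu (Z i0 @^-1` b) * nu (all_but @^-1` D))%E.
Proof.
have mD : measurable (all_but @^-1` D).
  rewrite (_ : _ @^-1` _ = \bigcup_(v in D) (all_but @^-1` [set v])).
    apply: fin_bigcup_measurable => // v _; exact: measurable_all_but.
  apply/seteqP; split => [w Dw|w [v Dv /= vw]]; first by exists (all_but w).
  by rewrite /preimage/= vw.
split => //.
have cut A v : A `&` all_but @^-1` D `&` all_but @^-1` [set v] =
    if v \in D then A `&` all_but @^-1` [set v] else set0.
  case: ifPn => [/set_mem Dv|/negP Dv]; apply/seteqP; split => w //=.
  - by move=> [[Aw _] vw].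
  - by move=> [Aw vw]; split => //; split => //; rewrite vw.
  - by move=> [[_ Dw] vw]; apply: Dv; rewrite -vw inE.
rewrite (measure_partition _ (f := all_but)) => [|v]; last first.
  by rewrite cut; case: ifP => // _; apply: measurableI; [exact: mZ|exact: measurable_all_but].
rewrite -[X in (_ * nu X)%E]setTI.
rewrite [X in (_ * X)%E](measure_partition _ (f := all_but)) => [|v]; last first.
  by rewrite cut; case: ifP => // _; rewrite setTI; exact: measurable_all_but.
rewrite ge0_sume_distrr//; apply: eq_bigr => v _; rewrite !cut.
case: ifP => _; rewrite ?measure0 ?mule0// setTI; exact: all_but_cell.
Qed.

End independent_of_rest.

Section erdos_renyi_conditional.
Context (R : realType) (m : nat) (hm : (3 <= m)%N) (p s : R).
Variable mu : probability (prodspace 'I_m R) R.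
Hypothesis hmu : erdos_renyi_law p s mu.
Local Notation f1 := (first hm).

(** If the maximum of the later entries is not zero, then X^0 = 1 and the first
    entry is xi^1, which is independent of X^0 and the other xi^k. If it is zero,
    then all the later entries vanish: they are constant on that event, and so
    independent of the first entry. *)
Lemma erdos_renyi_first_given_aggregate : exists kappa,
  first_given_aggregate hm mu (fun z => \big[Num.max/0]_k z k) kappa.
Proof.
have [d [T [nu [Z [indep _ _ muE]]]]] := hmu.
pose X (w : T) : prodspace 'I_m R := fun k => (Z None w)%:R * (Z (Some k) w)%:R.
have mZ i (b : set bool) : measurable (Z i @^-1` b).
  by rewrite -[X in measurable X]setTI; exact: measurable_funPT.
have mZR i : measurable_fun setT (fun w => (Z i w)%:R : R).
  apply: (measurableT_comp (f := fun b : bool => b%:R : R)) => //.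
have mX : measurable_fun setT X.
  by apply: measurable_fun_prodspace => k; apply: measurable_funM; exact: mZR.
have lawX A : measurable A -> mu A = nu (X @^-1` A) by exact: muE.
pose zero : set (prodspace 'I_m R) := [set x | forall k : later m, x (val k) = 0].
have mzero : measurable zero.
  rewrite (_ : zero = \bigcap_(k in [set: later m]) [set x | x (val k) = 0]).
    apply: fin_bigcap_measurable => // k _.
    rewrite (_ : mkset _ = (fun x : prodspace 'I_m R => x (val k)) @^-1` [set 0])//.
    by rewrite -[X in measurable X]setTI; exact: measurable_coord.
  by apply/seteqP; split => [x h k _|x h k]; apply: h.
pose agg (z : prodspace (later m) R) : R := \big[Num.max/0]_k z k.
have Xle k w : 0 <= X w k <= 1.
  by rewrite /X; case: (Z None w); case: (Z _ w); rewrite ?mulr0 ?mul0r ?mulr1 ?lexx ler01.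
have agg0 w : (agg (later_part (X w)) == 0) = `[< zero (X w) >].
  apply/eqP/asboolP => [ag k|zw].
    apply/eqP; rewrite eq_le; have /andP[-> _] := Xle (val k) w; rewrite andbT.
    by rewrite -[leRHS]ag; exact: (le_bigmax 0 (fun k => later_part (X w) k)).
  apply/eqP; rewrite eq_le bigmax_ge_id andbT; apply: bigmax_le => // k _.
  by rewrite [leLHS]zw.
pose kappa (y : R) (B : set R) : R :=
  if y == 0 then fine (mu ([set x | B (x f1)] `&` zero)) / fine (mu zero)
  else fine (nu (Z (Some f1) @^-1` [set b | B b%:R])).
have mB1 (B : set R) : measurable B -> measurable [set x : prodspace 'I_m R | B (x f1)].
  by move=> mB; rewrite -[X in measurable X]setTI; exact: measurable_coord.
have mkappa B : measurable_fun setT (kappa ^~ B).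
  rewrite (_ : kappa ^~ B = fun y => if y == 0 then kappa 0 B else kappa 1 B).
    apply: measurable_fun_ifT => //; apply: (measurable_fun_bool true).
    by rewrite setTI (_ : _ @^-1` _ = [set 0])//; apply/seteqP; split => y /= /eqP.
  by apply/funext => y; rewrite /kappa eqxx oner_eq0; case: ifP.
exists kappa; split.
- by move=> B _; exact: mkappa.
- move=> y B mB; rewrite /kappa; case: ifP => _.
    have mI : measurable ([set x : prodspace 'I_m R | B (x f1)] `&` zero) by apply: measurableI => //; exact: mB1.
    have [z0|z0] := eqVneq (fine (mu zero)) 0; first by rewrite z0 invr0 mulr0 lexx ler01.
    have zpos : 0 < fine (mu zero) by rewrite lt_neqAle eq_sym z0 fine_ge0.
    rewrite divr_ge0 ?fine_ge0//= ler_pdivrMr// mul1r.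
    by apply: fine_le; rewrite ?fin_num_measure//; apply: le_measure; rewrite ?inE//; exact: subIsetr.
  by rewrite fine_ge0//= -lee_fin fineK ?fin_num_measure ?probability_le1.
move=> B C mB mC.
have mC' : measurable [set x : prodspace 'I_m R | C (later_part x)].
  by rewrite -[X in measurable X]setTI; exact: measurable_later_part.
set C' := [set x : prodspace 'I_m R | C (later_part x)] in mC' *.
pose B' := [set x : prodspace 'I_m R | B (x f1)].
have mB' : measurable B' := mB1 B mB.
have magg : measurable_fun setT (fun x : prodspace 'I_m R => agg (later_part x)).
  by apply: measurable_bigmax => k; exact: (measurable_coord (val k)).
have mkap : measurable_fun setT (fun x : prodspace 'I_m R => (kappa (agg (later_part x)) B)%:E).
  by apply/measurable_EFinP; exact: (measurableT_comp (mkappa B) magg).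
have kap0 x : (0 <= (kappa (agg (later_part x)) B)%:E)%E.
  rewrite lee_fin /kappa; case: ifP => _; first by rewrite divr_ge0 ?fine_ge0.
  by rewrite fine_ge0.
have -> : (\int[mu]_(x in C') (kappa (agg (later_part x)) B)%:E =
    \int[nu]_(w in X @^-1` C') (kappa (agg (later_part (X w))) B)%:E)%E.
  rewrite -(ge0_integral_law nu mX mC' mkap kap0).
  by apply: (eq_measure_integral (law nu mX)) => A mA _; exact: lawX.
have mpre (A : set (prodspace 'I_m R)) : measurable A -> measurable (X @^-1` A).
  by move=> mA; rewrite -[X in measurable X]setTI; exact: mX.
rewrite (lawX _ (measurableI _ _ mB' mC')).
have mZ0 : measurable (X @^-1` zero) by exact: mpre.
have mXC : measurable (X @^-1` C') by exact: mpre.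
rewrite (measureDI nu (mpre _ (measurableI _ _ mB' mC')) mZ0).
rewrite -[X in (\int[nu]_(_ in X) _)%E](setUIDK _ (X @^-1` zero)).
rewrite (ge0_integral_setU nu (measurableI _ _ mXC mZ0) (measurableD mXC mZ0)); last 3 first.
- by apply: measurable_funTS; exact: (measurableT_comp mkap mX).
- by move=> w _; exact: kap0.
- by apply/disj_set2P; rewrite setDE setIACA setICr setI0.
rewrite [RHS]addeC; congr (_ + _)%E.
- pose D : set {ffun option 'I_m -> bool} := [set v : {ffun option 'I_m -> bool} |
    C (fun k => (v None)%:R * (v (Some (val k)))%:R) /\
    ~ forall k : later m, (v None)%:R * (v (Some (val k)))%:R = 0 :> R].
  have DE : X @^-1` C' `\` X @^-1` zero = all_but Z (Some f1) @^-1` D.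
    have XE w k : X w (val k) = (all_but Z (Some f1) w None)%:R *
        (all_but Z (Some f1) w (Some (val (k : later m))))%:R.
      rewrite !ffunE/=; case: eqP => // -[kf].
      by have := valP k; rewrite /= kf.
    have lE w : later_part (X w) = fun k : later m =>
        (all_but Z (Some f1) w None)%:R * (all_but Z (Some f1) w (Some (val k)))%:R.
      by apply/funext => k; rewrite -XE.
    apply/seteqP; split => w; rewrite /preimage /= /C' /zero /D /= lE.
      by move=> [Cw zw]; split => // h; apply: zw => k; rewrite XE; exact: h.
    by move=> [Cw zw]; split => // h; apply: zw => k; rewrite -XE; exact: h.
  have [mD E1] : measurable (X @^-1` C' `\` X @^-1` zero) /\
      nu (X @^-1` (B' `&` C') `\` X @^-1` zero) =
      (nu (Z (Some f1) @^-1` [set b | B b%:R]) *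
       nu (X @^-1` C' `\` X @^-1` zero))%E.
    have [mD ind] := independent_all_but (Some f1) indep [set b | B b%:R] D.
    rewrite DE; split => //; rewrite -ind -DE; congr (nu _).
    have on w : ~ zero (X w) -> Z None w = true.
      by move=> zw; apply: contrapT => /negP/negbTE h; apply: zw => k; rewrite /X h mul0r.
    have X1 w : ~ zero (X w) -> X w f1 = (Z (Some f1) w)%:R.
      by move=> /on h; rewrite /X h mul1r.
    apply/seteqP; split => w /=.
      by move=> [[Bw Cw] zw]; split => //; rewrite -X1.
    by move=> [Bw [Cw zw]]; split => //; split => //; rewrite /B' /= X1.
  apply: (etrans E1).
  rewrite (eq_integral (fun=> (fine (nu (Z (Some f1) @^-1` [set b | B b%:R])))%:E)).
    by rewrite integral_cst// fineK ?fin_num_measure.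
  move=> w /set_mem[_ zw]; rewrite /kappa agg0 ifF//.
  by apply/asboolPn.
- rewrite (eq_integral (fun=> (kappa 0 B)%:E)); last first.
    by move=> w /set_mem[_ zw]; congr (kappa _ B)%:E; apply/eqP; rewrite agg0; exact/asboolP.
  rewrite integral_cst//; last exact: measurableI.
  have [C0|C0] := pselect (C (fun=> 0)); last first.
    have E0 : X @^-1` C' `&` X @^-1` zero = set0.
      apply/seteqP; split => // w [Cw zw]; apply: C0.
      by rewrite (_ : (fun=> 0) = later_part (X w))//; apply/funext => k; rewrite [RHS]zw.
    rewrite preimage_setI -setIA E0 setI0 measure0.
    by rewrite ?measure0 mule0.
  have sub : X @^-1` zero `<=` X @^-1` C'.
    move=> w zw; rewrite /preimage /= /C' /=.
    by rewrite (_ : later_part _ = fun=> 0)//; apply/funext => k; rewrite [LHS]zw.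
  rewrite preimage_setI -setIA (setIidr sub) -preimage_setI.
  apply: (etrans (esym (lawX _ (measurableI _ _ mB' mzero)))).
  rewrite [X in (_ * X)%E](_ : _ = mu zero); last exact: (esym (lawX _ mzero)).
  rewrite /kappa eqxx.
  have mI : measurable (B' `&` zero) by exact: measurableI.
  rewrite -[mu (B' `&` zero)]fineK ?fin_num_measure// -[mu zero]fineK ?fin_num_measure//.
  rewrite -EFinM; congr EFin.
  have [z0|z0] := eqVneq (fine (mu zero)) 0; last by rewrite divfK.
  rewrite z0 mulr0; apply/eqP; rewrite eq_le fine_ge0// andbT -z0.
  by apply: fine_le; rewrite ?fin_num_measure//; apply: le_measure; rewrite ?inE//; exact: subIsetr.
Qed.

End erdos_renyi_conditional.

(** * Uniqueness of finite measures and product rules *)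

Section density_measure.
Context d (T : measurableType d) (R : realType).
Variables (mu : {measure set T -> \bar R}) (p : T -> R).

Definition density_measure (mp : measurable_fun setT p)
    (p0 : forall x, 0 <= p x) (A : set T) : \bar R :=
  (\int[mu]_(x in A) (p x)%:E)%E.

Hypotheses (mp : measurable_fun setT p) (p0 : forall x, 0 <= p x).
Local Notation dens := (density_measure mp p0).

Let dens0 : dens set0 = 0%E.
Proof. by rewrite /density_measure integral_set0. Qed.

Let dens_ge0 A : (0 <= dens A)%E.
Proof. by apply: integral_ge0 => x _; rewrite lee_fin. Qed.

Let dens_sigma_additive : semi_sigma_additive dens.
Proof.
move=> F mF tF mUF; rewrite /density_measure ge0_integral_bigcup//; last 2 first.
- by apply: measurable_funTS; apply/measurable_EFinP.
- by move=> x _; rewrite lee_fin.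
apply: is_cvg_ereal_nneg_natsum_cond => n _ _.
by apply: integral_ge0 => x _; rewrite lee_fin.
Qed.

HB.instance Definition _ := isMeasure.Build _ _ _ dens
  dens0 dens_ge0 dens_sigma_additive.

Lemma integral_density_measure (f : T -> \bar R) :
  measurable_fun setT f -> (forall x, (0 <= f x)%E) ->
  (\int[dens]_x f x = \int[mu]_x (f x * (p x)%:E))%E.
Proof. by apply: ge0_integral_density. Qed.

End density_measure.

Section finite_measure_uniqueness.
Context d d' (T : measurableType d) (S : measurableType d') (R : realType).

Definition image_measure (mu : {measure set T -> \bar R}) (f : T -> S)
    (mf : measurable_fun setT f) : {measure set S -> \bar R} :=
  measure_function_pushforward__canonical__measure_function_Measure mu mf.

Lemma finite_measure_unique (m1 m2 : {measure set T -> \bar R}) (f : T -> S)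
    (G : set (set S)) : measurable_fun setT f ->
  G `<=` measurable -> measurable `<=` <<s G>> -> setI_closed G -> G setT ->
  (m1 setT < +oo)%E -> (forall A, G A -> m1 (f @^-1` A) = m2 (f @^-1` A)) ->
  forall A, measurable A -> m1 (f @^-1` A) = m2 (f @^-1` A).
Proof.
move=> mf Gm mG GI GT fin eqG A mA.
apply: (@measure_unique _ _ _ G (fun=> setT) _ _ _ _ (image_measure m1 mf)
  (image_measure m2 mf)) => //.
- apply/seteqP; split; first exact: mG.
  by apply: smallest_sub => //; exact: sigma_algebra_measurable.
- by rewrite bigcup_const.
Qed.

End finite_measure_uniqueness.

Definition rectangles (I : finType) (T : Type) (G : set (set T)) :
    set (set (I -> T)) :=
  [set A | exists2 B : I -> set T, (forall i, G (B i)) &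
     A = [set x | forall i, B i (x i)]].

Lemma rectanglesI (I : finType) (T : Type) (G : set (set T)) :
  setI_closed G -> setI_closed (@rectangles I _ G).
Proof.
move=> GI _ _ [B GB ->] [C GC ->]; exists (fun i => B i `&` C i).
  by move=> i; exact: GI.
by apply/seteqP; split => x /= => [[h k] i|h]; [|split => i; case: (h i)].
Qed.

Lemma rectanglesT (I : finType) (T : Type) (G : set (set T)) :
  G setT -> @rectangles I _ G setT.
Proof. by move=> GT; exists (fun=> setT) => //; apply/seteqP. Qed.

Section rectangles.
Context (I : finType) d (T : measurableType d) (G : set (set T)).

Lemma rectangles_measurable : G `<=` measurable ->
  rectangles G `<=` @measurable _ (prodspace I T).
Proof.
move=> Gm _ [B GB ->].
rewrite (_ : mkset _ = \bigcap_(i in [set: I]) ((fun x : prodspace I T => x i) @^-1` B i)).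
  apply: fin_bigcap_measurable => // i _.
  by rewrite -[X in measurable X]setTI; apply: measurable_coord => //; exact: Gm.
by apply/seteqP; split => [x h i _|x h i]; apply: h.
Qed.

(** A cylinder is a rectangle with all the sides but one equal to the whole space. *)
Lemma rectangles_generate : measurable `<=` <<s G>> -> G setT ->
  @measurable _ (prodspace I T) `<=` <<s @rectangles I _ G>>.
Proof.
move=> Ggen GT; apply: smallest_sub; first exact: smallest_sigma_algebra.
move=> _ [i _ [B mB <-]]; rewrite setTI.
suff sub : measurable `<=`
    image_set_system setT (fun x : I -> T => x i) (<<s @rectangles I _ G>>).
  by have := sub _ mB; rewrite /image_set_system/= setTI.
apply: (subset_trans Ggen); apply: smallest_sub.
  by apply: sigma_algebra_image; exact: smallest_sigma_algebra.
move=> D GD; rewrite /image_set_system/= setTI; apply: sub_gen_smallest.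
exists (fun j => if j == i then D else setT); first by move=> j; case: ifP.
apply/seteqP; split => x /=; last by move=> /(_ i); rewrite eqxx.
by move=> Dx j; case: eqVneq => // ->.
Qed.

End rectangles.

Section same_pushforward.
Context d d' (T : measurableType d) (S : measurableType d') (R : realType).

Lemma same_pushforward_integral (m1 m2 : {measure set T -> \bar R}) (X : T -> S)
    (f : S -> \bar R) : measurable_fun setT X ->
  (forall A, measurable A -> m1 (X @^-1` A) = m2 (X @^-1` A)) ->
  measurable_fun setT f -> (forall x, (0 <= f x)%E) ->
  (\int[m1]_w f (X w) = \int[m2]_w f (X w))%E.
Proof.
move=> mX same mf f0.
pose Y := mfun_Sub (mem_set mX).
have E (m : {measure set T -> \bar R}) :
    (\int[m]_w f (X w) = \int[pushforward m Y]_y f y)%E.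
  by rewrite ge0_integral_pushforward// preimage_setT.
rewrite !E; apply: eq_measure_integral => A mA _; exact: same.
Qed.

End same_pushforward.

Lemma integral_mrestr d (T : measurableType d) (R : realType)
    (mu : {measure set T -> \bar R}) (D : set T) (mD : measurable D)
    (f : T -> \bar R) : measurable_fun setT f -> (forall x, (0 <= f x)%E) ->
  (\int[mrestr mu mD]_x f x = \int[mu]_(x in D) f x)%E.
Proof.
move=> mf f0.
rewrite (ge0_integral_density (p := \1_D) (mu := mu))//.
- by rewrite [RHS]integral_setE; apply: eq_integral => x _; rewrite muleC.
- by move=> A mA; rewrite integral_indic// setIC.
Qed.

Section product_of_functions.
Context d d' (T : measurableType d) (S : measurableType d') (R : realType)
  (I : finType).
Variables (m : {measure set T -> \bar R}) (mu : probability S R)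
  (Z : I -> T -> S) (k : R).
Hypotheses (mZ : forall e, measurable_fun setT (Z e)) (k0 : 0 <= k).
Hypothesis prodE : forall B : I -> set S, (forall e, measurable (B e)) ->
  m [set w | forall e, B e (Z e w)] = (k * \prod_e fine (mu (B e)))%:E.

Let product_rule (g : I -> S -> R) :=
  (\int[m]_w (\prod_e g e (Z e w))%:E =
   (k * \prod_e fine (\int[mu]_x (g e x)%:E))%:E)%E.

Let mpre (A : set S) e : measurable A -> measurable (Z e @^-1` A).
Proof. by move=> mA; rewrite -[X in measurable X]setTI; exact: mZ. Qed.

Let product_rule_indic (B : I -> set S) : (forall e, measurable (B e)) ->
  product_rule (fun e => \1_(B e)).
Proof.
move=> mB; rewrite /product_rule.
have mU : measurable [set w | forall e, B e (Z e w)].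
  rewrite (_ : mkset _ = \bigcap_(e in [set: I]) (Z e @^-1` B e)).
    by apply: fin_bigcap_measurable => // e _; exact: mpre.
  by apply/seteqP; split => [w h e _|w h e]; apply: h.
transitivity (\int[m]_w (\1_[set w | forall e, B e (Z e w)] w)%:E)%E.
  apply: eq_integral => w _; congr EFin; rewrite [RHS]indicE.
  have [/set_mem Bw|/negP Bw] := boolP (w \in _).
    by rewrite big1// => e _; rewrite indicE mem_set.
  have [e Be] : exists e, ~ B e (Z e w).
    by apply/existsNP => h; apply: Bw; rewrite inE.
  by rewrite (bigD1 e)//= indicE memNset// mul0r.
rewrite integral_indic// setIT prodE//; congr (k * _)%:E.
by apply: eq_bigr => e _; rewrite integral_indic// setIT.
Qed.

(** Indicators are replaced with functions one factor at a time: with the other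
    factors fixed, both sides are integrals of that factor with respect to two
    measures, which agree on events by the previous step. In the induction the
    factors outside the list [s] are indicators. *)
Lemma integral_prod (g : I -> S -> R) :
  (forall e, measurable_fun setT (g e)) -> (forall e x, 0 <= g e x <= 1) ->
  (\int[m]_w (\prod_e g e (Z e w))%:E =
   (k * \prod_e fine (\int[mu]_x (g e x)%:E))%:E)%E.
Proof.
suff step (s : seq I) : forall g : I -> S -> R,
    (forall e, measurable_fun setT (g e)) -> (forall e x, 0 <= g e x <= 1) ->
    (forall e, e \notin s -> exists2 B, measurable B & g e = \1_B) ->
    product_rule g.
  by move=> mg g01; apply: (step (index_enum I)) => // e; rewrite mem_index_enum.
elim: s => [|e0 s IH] {}g mg g01 ginE.
  have /choice[B hB] : forall e, exists B, measurable B /\ g e = \1_B.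
    by move=> e; have [B mB ->] := ginE e isT; exists B.
  rewrite (_ : g = fun e => \1_(B e)); last by apply/funext => e; case: (hB e).
  by apply: product_rule_indic => e; case: (hB e).
have g0 e x : 0 <= g e x by case/andP: (g01 e x).
pose gA A e := if e == e0 then \1_A else g e.
have ruleA A : measurable A -> product_rule (gA A).
  move=> mA; apply: IH => [e|e x|e es]; rewrite /gA; case: eqVneq => // ee0.
  - by rewrite indicE ler0n lern1; case: (_ \in _).
  - by exists A.
  - by apply: ginE; rewrite inE negb_or ee0.
pose p w := \prod_(e | e != e0) g e (Z e w).
have mp : measurable_fun setT p.
  have -> : p = fun w => \prod_e (if e != e0 then g e (Z e w) else 1).
    by apply/funext => w; rewrite /p big_mkcond.
  apply: measurable_prod => e _; case: (e != e0) => //.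
  exact: (measurableT_comp (mg e) (mZ e)).
have p0 w : 0 <= p w by apply: prodr_ge0 => e _.
pose C := k * \prod_(e | e != e0) fine (\int[mu]_x (g e x)%:E)%E.
have C0 : 0 <= C.
  apply: mulr_ge0 => //; apply: prodr_ge0 => e _; apply: fine_ge0.
  by apply: integral_ge0 => x _; rewrite lee_fin.
have lawN A : measurable A ->
    density_measure m mp p0 (Z e0 @^-1` A) = mscale (NngNum C0) mu A.
  move=> mA; rewrite /density_measure integral_setE.
  transitivity (\int[m]_w (\prod_e gA A e (Z e w))%:E)%E.
    apply: eq_integral => w _; rewrite -EFinM; congr EFin.
    rewrite [RHS](bigD1 e0)//= /gA eqxx; congr (_ * _).
    by apply: eq_bigr => e /negbTE->.
  rewrite ruleA// (bigD1 e0)//= /gA eqxx integral_indic// setIT.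
  rewrite /mscale/= -[mu A in RHS]fineK ?fin_num_measure// -EFinM; congr EFin.
  rewrite /C mulrCA mulrC; congr (_ * _ * _).
  by apply: eq_bigr => e /negbTE->.
have mEg : measurable_fun setT (fun x => (g e0 x)%:E) by apply/measurable_EFinP.
rewrite /product_rule.
transitivity (\int[density_measure m mp p0]_w (g e0 (Z e0 w))%:E)%E.
  rewrite integral_density_measure//.
  - by apply: eq_integral => w _; rewrite -EFinM (bigD1 e0).
  - exact: (measurableT_comp mEg (mZ e0)).
  - by move=> w; rewrite lee_fin.
pose Y := mfun_Sub (mem_set (mZ e0)).
transitivity (\int[pushforward (density_measure m mp p0) Y]_x (g e0 x)%:E)%E.
  by rewrite ge0_integral_pushforward// ?preimage_setT// => x _; rewrite lee_fin.
rewrite (eq_measure_integral (mscale (NngNum C0) mu)); last by move=> A mA _; exact: lawN.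
rewrite ge0_integral_mscale//; last by move=> x _; rewrite lee_fin.
have fi : (\int[mu]_x (g e0 x)%:E)%E \is a fin_num.
  rewrite ge0_fin_numE; last by apply: integral_ge0 => x _; rewrite lee_fin.
  apply: (@le_lt_trans _ _ (\int[mu]_x 1)%E).
    apply: ge0_le_integral => // x _; rewrite lee_fin//.
    by case/andP: (g01 e0 x).
  by rewrite integral_cst// mul1e ltey_eq fin_num_measure.
rewrite -[in LHS](fineK fi) -EFinM; congr EFin.
by rewrite (bigD1 e0)//= /C; ring.
Qed.

End product_of_functions.

(** * The planted model *)

Definition aggregate_value (R : realType) (m : nat) (M : model R)
    (z : prodspace (later m) R) : R :=
  match M with
  | Gaussian _ => \sum_k z k
  | ErdosRenyi _ _ => \big[Num.max/0]_k z k
  end.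

Lemma edge_law_first_given_aggregate (R : realType) (m : nat) (hm : (3 <= m)%N)
    (M : model R) (mu : probability (prodspace 'I_m R) R) :
  admissible M -> edge_law M mu ->
  exists kappa, first_given_aggregate hm mu (aggregate_value M) kappa.
Proof.
case: M => [rho|p s] /= hM hmu.
  exact: (gaussian_first_given_aggregate hm hmu hM).
exact: (erdos_renyi_first_given_aggregate hm hmu).
Qed.

Lemma edge_act1 n (e : edge n) : edge_act 1%g e = e.
Proof.
apply: val_inj => /=; rewrite -[RHS]imset_id.
by apply: eq_imset => i; rewrite perm1.
Qed.

Lemma edge_actM n (s t : {perm 'I_n}) (e : edge n) :
  edge_act (s * t)%g e = edge_act t (edge_act s e).
Proof.
apply: val_inj => /=; rewrite -imset_comp.
by apply: eq_imset => i; rewrite permM.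
Qed.

Lemma edge_actK n (s : {perm 'I_n}) : cancel (edge_act s) (edge_act s^-1).
Proof. by move=> e; rewrite -edge_actM mulgV edge_act1. Qed.

Lemma edge_actKV n (s : {perm 'I_n}) : cancel (edge_act s^-1) (edge_act s).
Proof. by move=> e; rewrite -edge_actM mulVg edge_act1. Qed.

Lemma measurable_graph_coord (R : realType) (m n : nat) (k : 'I_m) (e : edge n) :
  measurable_fun setT (fun x : obs R m n => x k e).
Proof.
exact: (measurableT_comp (measurable_coord (T := R) e)
  (measurable_coord (T := prodspace (edge n) R) k)).
Qed.

Lemma measurable_rest (R : realType) (m n : nat) :
  measurable_fun setT (@rest R m n).
Proof.
apply: measurable_fun_prodspace => k.
exact: (measurable_coord (T := prodspace (edge n) R) (val k)).
Qed.

Section aggregates.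
Context (R : realType) (m n : nat) (hm : (3 <= m)%N) (M : model R).

Lemma aggregateE (x : lobs R m n) t e :
  aggregate hm M x t e =
  aggregate_value M (fun k => x k (edge_act (t (second hm, k)) e)).
Proof. by rewrite /aggregate /aggregate_value; case: M. Qed.

Lemma measurable_aggregate_value : measurable_fun setT (@aggregate_value R m M).
Proof.
rewrite /aggregate_value; case: M => [_|_ _].
  by apply: measurable_sum => k; exact: measurable_coord.
by apply: measurable_bigmax => k; exact: measurable_coord.
Qed.

Lemma measurable_aggregate t :
  measurable_fun setT (fun x : lobs R m n => aggregate hm M x t : graph R n).
Proof.
apply: measurable_fun_prodspace => e.
have -> : (fun x : lobs R m n => aggregate hm M x t e) =
    aggregate_value M \o (fun x k => x k (edge_act (t (second hm, k)) e)).
  by apply/funext => x; rewrite /= aggregateE.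
apply: (measurableT_comp measurable_aggregate_value).
apply: measurable_fun_prodspace => k.
exact: (measurableT_comp (measurable_coord (T := R) _)
  (measurable_coord (T := prodspace (edge n) R) k)).
Qed.

End aggregates.

Lemma measurable_from_permfam (I : finType) n d (S : measurableType d)
    (f : permfam I n -> S) : measurable_fun setT f.
Proof. by []. Qed.

Lemma measurable_permfam (I : finType) n (A : set (permfam I n)) : measurable A.
Proof. by []. Qed.

(** The second coordinate takes finitely many values. *)
Lemma measurable_prod_permfam (I : finType) n d d' (S : measurableType d)
    (S' : measurableType d') (f : S * permfam I n -> S') :
  (forall t, measurable_fun setT (fun x => f (x, t))) -> measurable_fun setT f.
Proof.
move=> mf _ A mA; rewrite setTI.
rewrite (_ : f @^-1` A = \bigcup_(t in [set: permfam I n])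
    ((fun x => f (x, t)) @^-1` A `*` [set t])); last first.
  apply/seteqP; split=> [[x t] /= h|[x t] [t' _ [/= h ->//]]].
  by exists t.
apply: fin_bigcup_measurable => // t _; apply: measurableX => //.
by rewrite -[X in measurable X]setTI; exact: mf.
Qed.

Definition slice (S I : Type) (C : set (S * I)) (t : I) : set S :=
  [set x | C (x, t)].

Lemma measurable_slice d d' (S : measurableType d) (I : measurableType d')
    (C : set (S * I)) t : measurable C -> measurable (slice C t).
Proof.
move=> mC; rewrite -[X in measurable X]setTI.
exact: (pair2_measurable t measurableT mC).
Qed.

Lemma measurable_relative_pair (R : realType) (m n : nat) d (T : measurableType d)
    (X : {mfun T >-> obs R m n}) (pistar : {mfun T >-> permfam 'I_m n}) :
  measurable_fun setT (fun w => (rest (X w), relative (pistar w))).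
Proof.
apply/measurable_fun_pairP; split.
  exact: (measurableT_comp (@measurable_rest R m n) (measurable_funPT X)).
exact: (measurableT_comp (measurable_from_permfam (@relative m n)) (measurable_funPT pistar)).
Qed.

Section planted_model.
Context (R : realType) (m n : nat) (hm : (3 <= m)%N) (M : model R).
Context (d : measure_display) (T : measurableType d) (P : probability T R).
Variables (X : {mfun T >-> obs R m n}) (pistar : {mfun T >-> permfam 'I_m n}).
Variable mu : probability (prodspace 'I_m R) R.
Variable kappa : R -> set R -> R.
Local Notation f1 := (first hm).
Local Notation aligns := (alignments n hm).
Hypothesis unif : forall a : permfam 'I_m n, P (pistar @^-1` [set a]) =
  if a \in aligns then (#|aligns|%:R^-1)%:E else 0%E.
Hypothesis indep : forall (a : permfam 'I_m n) (B : edge n -> set (prodspace 'I_m R)),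
  a \in aligns -> (forall e, measurable (B e)) ->
  P (pistar @^-1` [set a] `&`
     [set w | forall e, B e (fun k => X w k (edge_act (a k) e))]) =
  (P (pistar @^-1` [set a]) * (\prod_(e : edge n) fine (mu (B e)))%:E)%E.
Hypothesis hkappa : first_given_aggregate hm mu (aggregate_value M) kappa.

Let D (a : permfam 'I_m n) := pistar @^-1` [set a].

Let mD a : measurable (D a).
Proof. by rewrite -[X in measurable X]setTI; exact: measurable_funPT. Qed.

Let aligned (a : permfam 'I_m n) (e : edge n) (w : T) : prodspace 'I_m R :=
  fun k => X w k (edge_act (a k) e).

Let measurable_aligned a e : measurable_fun setT (aligned a e).
Proof.
apply: measurable_fun_prodspace => k.
exact: (measurableT_comp (measurable_graph_coord k (edge_act (a k) e)) (measurable_funPT X)).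
Qed.

Let mrestX : measurable_fun setT (fun w => rest (X w)).
Proof. exact: (measurableT_comp (@measurable_rest R m n) (measurable_funPT X)). Qed.

Let first1 a e : a \in aligns -> edge_act (a f1) e = e.
Proof. by rewrite inE => /eqP->; exact: edge_act1. Qed.

(* The aggregate is indexed by the vertices of X^2, so its entry at pi_2(e) is the
   aggregate of the aligned vector at [e]. *)
Let aggregate_aligned a e w :
  aggregate hm M (rest (X w)) (relative a) (edge_act (a (val (second hm))) e) =
  aggregate_value M (later_part (aligned a e w)).
Proof.
rewrite aggregateE; congr aggregate_value; apply/funext => k.
rewrite /rest /later_part /aligned ffunE/= -edge_actM mulgA mulgV mul1g//.
Qed.

Let boxes : set (set (lobs R m n)) :=
  rectangles (rectangles (@measurable _ R)).

Let boxes_measurable : boxes `<=` measurable.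
Proof. by apply: rectangles_measurable; exact: rectangles_measurable. Qed.

Let boxes_generate : measurable `<=` <<s boxes>>.
Proof.
apply: rectangles_generate; last exact: rectanglesT.
by apply: rectangles_generate => //; exact: sub_gen_smallest.
Qed.

Let boxesI : setI_closed boxes.
Proof. by apply: rectanglesI; apply: rectanglesI => A B mA mB; exact: measurableI. Qed.

Let boxesT : boxes setT.
Proof. by do 2 apply: rectanglesT. Qed.

Let boxesE A : boxes A -> exists C : later m -> edge n -> set R,
  (forall k e, measurable (C k e)) /\
  A = [set x | forall k e, C k e (x k e)].
Proof.
move=> [B hB ->].
have /choice[C hC] : forall k, exists C : edge n -> set R,
    (forall e, measurable (C e)) /\ B k = [set y | forall e, C e (y e)].
  by move=> k; have [C mC ->] := hB k; exists C.
exists C; split; first by move=> k; case: (hC k).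
by apply/seteqP; split => x /= h k; have := h k; have [_ ->] := hC k.
Qed.

Let cell (a : permfam 'I_m n) (C : later m -> edge n -> set R) (e : edge n) :
    set (prodspace (later m) R) :=
  [set z | forall k, C k (edge_act (a (val k)) e) (z k)].

Let measurable_cell a C e : (forall k e, measurable (C k e)) ->
  measurable (cell a C e).
Proof.
move=> mC; apply: (rectangles_measurable (G := @measurable _ R)) => //.
by exists (fun k => C k (edge_act (a (val k)) e)).
Qed.

Let cell_aligned a C w :
  (forall k e, C k e (rest (X w) k e)) <->
  (forall e, cell a C e (later_part (aligned a e w))).
Proof.
split=> [h e k|h k e]; first exact: h.
have := h (edge_act (a (val k))^-1 e) k.
by rewrite /later_part /aligned /rest edge_actKV.
Qed.

Let mfirst (B : edge n -> set R) : (forall e, measurable (B e)) ->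
  measurable [set w | forall e, B e (X w f1 e)].
Proof.
move=> mB.
rewrite (_ : mkset _ = \bigcap_(e in [set: edge n]) ((fun w => X w f1 e) @^-1` B e)).
  apply: fin_bigcap_measurable => // e _; rewrite -[X in measurable X]setTI.
  exact: (measurableT_comp (measurable_graph_coord f1 e) (measurable_funPT X)).
by apply/seteqP; split => [w h e _|w h e]; apply: h.
Qed.

Let box_event a B C e : set (prodspace 'I_m R) :=
  [set x | B e (x f1) /\ cell a C e (later_part x)].

Let measurable_box_event a (B : edge n -> set R) C e :
  measurable (B e) -> (forall k e, measurable (C k e)) ->
  measurable (box_event a B C e).
Proof.
move=> mB mC; apply: measurableI.
  by rewrite -[X in measurable X]setTI; exact: (measurable_coord (T := R) f1).
rewrite -[X in measurable X]setTI; apply: measurable_later_part => //.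
exact: measurable_cell.
Qed.

Let box_probability a (B : edge n -> set R) C : a \in aligns ->
  (forall e, measurable (B e)) -> (forall k e, measurable (C k e)) ->
  P (D a `&` [set w | (forall e, B e (X w f1 e)) /\
                      forall k e, C k e (rest (X w) k e)]) =
  (P (D a) * (\prod_e fine (mu (box_event a B C e)))%:E)%E.
Proof.
move=> ha mB mC; rewrite -indep//; last by move=> e; exact: measurable_box_event.
congr (P (_ `&` _)); apply/seteqP; split => w /=.
  move=> [hB /cell_aligned hC] e; split; last exact: hC.
  by rewrite (first1 e ha).
move=> h; split=> [e|]; last by apply/cell_aligned => e; have [_ hC] := h e; exact: hC.
by have [] := h e; rewrite (first1 e ha).
Qed.

Let given (a : permfam 'I_m n) := mrestr P (mD a).

Let edge_weight (B : edge n -> set R) (s : {perm 'I_n}) (y : graph R n) : R :=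
  \prod_e kappa (y (edge_act s e)) (B e).

Let kappa01 (B : edge n -> set R) : (forall e, measurable (B e)) ->
  forall y e, 0 <= kappa y (B e) <= 1.
Proof. by move=> mB y e; have [_ h _] := hkappa; exact: h. Qed.

Let measurable_edge_weight (B : edge n -> set R) s : (forall e, measurable (B e)) ->
  measurable_fun setT (edge_weight B s).
Proof.
move=> mB; have [mk _ _] := hkappa.
apply: measurable_prod => e _.
exact: (measurableT_comp (mk _ (mB e)) (measurable_coord (T := R) (edge_act s e))).
Qed.

Let edge_weight_ge0 (B : edge n -> set R) s y : (forall e, measurable (B e)) ->
  0 <= edge_weight B s y.
Proof.
by move=> mB; apply: prodr_ge0 => e _; case/andP: (kappa01 mB (y (edge_act s e)) e).
Qed.

Let weight_given (B : edge n -> set R) (a : permfam 'I_m n) (x : lobs R m n) : R :=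
  edge_weight B (a (val (second hm))) (aggregate hm M x (relative a)).

Let measurable_weight_given (B : edge n -> set R) (a : permfam 'I_m n) :
  (forall e, measurable (B e)) -> measurable_fun setT (weight_given B a).
Proof.
move=> mB; apply: measurableT_comp; first exact: measurable_edge_weight.
exact: measurable_aggregate.
Qed.

(** Given the alignment, the first graph has independent entries with laws [kappa]
    at the aggregate. Both sides are finite measures in [C]. On boxes the left
    one is a product over the edges by the planted law, and the right one by
    [integral_prod]; the factors agree by [first_given_aggregate]. *)
Lemma given_alignment (a : permfam 'I_m n) (B : edge n -> set R) : a \in aligns ->
  (forall e, measurable (B e)) -> forall C, measurable C ->
  P (D a `&` [set w | (forall e, B e (X w f1 e)) /\ C (rest (X w))]) =
  (\int[given a]_(w in [set w | C (rest (X w))])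
     (weight_given B a (rest (X w)))%:E)%E.
Proof.
move=> ha mB.
have mEv := mfirst mB.
have mp : measurable_fun setT (fun w => weight_given B a (rest (X w))).
  exact: (measurableT_comp (measurable_weight_given a mB) mrestX).
have p0 w : 0 <= weight_given B a (rest (X w)) by exact: edge_weight_ge0.
have mDB := measurableI _ _ (mD a) mEv.
have mrE A : mrestr P mDB [set w | A (rest (X w))] =
    P (D a `&` [set w | (forall e, B e (X w f1 e)) /\ A (rest (X w))]).
  rewrite -[LHS]/(P ([set w | A (rest (X w))] `&` (D a `&` [set w | forall e, B e (X w f1 e)]))).
  by congr (P _); apply/seteqP; split => w /=; tauto.
move=> C mC; rewrite -mrE -[RHS]/(density_measure (given a) mp p0 [set w | C (rest (X w))]).
move: C mC; apply: (finite_measure_unique mrestX boxes_measurable boxes_generate boxesI boxesT).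
  by rewrite -ge0_fin_numE ?measure_ge0//; apply: (fin_num_measure P); exact: measurableI.
move=> A bA; apply: (etrans (mrE A)); have [C [mC AE]] := boxesE bA.
rewrite AE box_probability//.
rewrite -[RHS]/(\int[given a]_(w in [set w | [set x | forall k e, C k e (x k e)] (rest (X w))]) (weight_given B a (rest (X w)))%:E)%E.
rewrite integral_setE.
pose g e (x : prodspace 'I_m R) : R :=
  \1_(cell a C e) (later_part x) * kappa (aggregate_value M (later_part x)) (B e).
rewrite (eq_integral (fun w => (\prod_e g e (aligned a e w))%:E)); last first.
  move=> w _; rewrite -EFinM; congr EFin; rewrite big_split/=; congr (_ * _).
    rewrite indicE; have [/set_mem/= Bw|/negP Bw] := boolP (w \in _).
      by rewrite big1// => e _; rewrite indicE mem_set//; move: e; apply/cell_aligned.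
    have [e Be] : exists e, ~ cell a C e (later_part (aligned a e w)).
      by apply/existsNP => h; apply: Bw; rewrite inE/=; apply/cell_aligned.
    by rewrite (bigD1 e)//= indicE memNset// mul0r.
  apply: eq_bigr => e _; rewrite -aggregate_aligned//.
have Dfin : P (D a) \is a fin_num by rewrite fin_num_measure.
have [mk _ hk] := hkappa.
have mg e : measurable_fun setT (g e).
  apply: measurable_funM.
    by apply: (measurableT_comp _ (@measurable_later_part R m)); apply: measurable_indic; exact: measurable_cell.
  apply: (measurableT_comp (mk _ (mB e))).
  exact: (measurableT_comp (measurable_aggregate_value M) (@measurable_later_part R m)).
rewrite (integral_prod (mu := mu) (k := fine (P (D a))))//.
- rewrite EFinM fineK//; congr (_ * (_)%:E)%E; apply: eq_bigr => e _; congr fine.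
  rewrite hk//; last exact: measurable_cell.
  rewrite integral_setE; apply: eq_integral => x _; rewrite -EFinM.
  by congr EFin.
- by rewrite fine_ge0.
- move=> B' mB'; rewrite EFinM fineK// -indep//.
  by rewrite -[LHS]/(P ([set w | forall e, B' e (aligned a e w)] `&` D a)) setIC.
- move=> e x; rewrite /g indicE; case: (_ \in _); rewrite ?mul0r ?mul1r ?lexx ?ler01//.
  exact: kappa01.
Qed.

(* The composition of all the later permutations with [s]. *)
Let shift (s : {perm 'I_n}) (a : permfam 'I_m n) : permfam 'I_m n :=
  [ffun k => if k == f1 then a k else (s * a k)%g].

Let shift_later s a k : shift s a (val (k : later m)) = (s * a (val k))%g.
Proof. by rewrite ffunE; case: eqP => // E; have := valP k; rewrite /= E. Qed.

Let shift_aligns s a : (shift s a \in aligns) = (a \in aligns).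
Proof. by rewrite !inE ffunE eqxx. Qed.

Let relative_shift s a : relative (shift s a) = relative a.
Proof.
by apply/ffunP => kl; rewrite ffunE [RHS]ffunE !shift_later invMg mulgA mulgKV.
Qed.

Let shiftK s : cancel (shift s) (shift s^-1).
Proof.
by move=> a; apply/ffunP => k; rewrite !ffunE; case: eqP => // _; rewrite mulgA mulVg mul1g.
Qed.

(* On boxes the probabilities are products over the edges, and the shift permutes
   the factors. *)
Let rest_shift s a C : a \in aligns -> measurable C ->
  given a [set w | C (rest (X w))] = given (shift s a) [set w | C (rest (X w))].
Proof.
move=> ha mC.
have mT (e : edge n) : measurable [set: R] by [].
move: C mC; apply: (finite_measure_unique mrestX boxes_measurable boxes_generate boxesI boxesT).
  rewrite -ge0_fin_numE ?measure_ge0//; apply: (fin_num_measure P); exact: measurableI.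
move=> A bA; have [C [mC ->]] := boxesE bA.
have E b : given b [set w | forall k e, C k e (rest (X w) k e)] =
    P (D b `&` [set w | (forall e : edge n, [set: R] (X w f1 e)) /\ forall k e, C k e (rest (X w) k e)]).
  rewrite -[LHS]/(P ([set w | forall k e, C k e (rest (X w) k e)] `&` D b)).
  by congr (P _); apply/seteqP; split => w /=; tauto.
apply: (etrans (E a)); apply: (etrans _ (esym (E _))).
rewrite (box_probability ha mT mC) (box_probability _ mT mC) ?shift_aligns//.
rewrite !unif shift_aligns ha; congr (_ * (_)%:E)%E.
rewrite (reindex_inj (can_inj (edge_actK s)))/=; apply: eq_bigr => e _.
congr (fine (mu _)); apply/seteqP; split => x /= [_ h]; split=> // k.
  by rewrite shift_later edge_actM; exact: h.
by have := h k; rewrite shift_later edge_actM.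
Qed.

Local Notation relt := (relperm m n).

(* The contribution of the alignment [a] to the probability of [B] and [C], if
   its second permutation is taken to be [s] in the law of the first graph. *)
Let share (B : edge n -> set R) C (a : permfam 'I_m n) (s : {perm 'I_n}) : \bar R :=
  (\int[given a]_w ((\1_(slice C (relative a)) (rest (X w)))%:E *
    (edge_weight B s (aggregate hm M (rest (X w)) (relative a)))%:E))%E.

Let share_ge0 B C a s : (forall e, measurable (B e)) -> (0 <= share B C a s)%E.
Proof.
move=> mB; apply: integral_ge0 => w _.
by rewrite mule_ge0// lee_fin// edge_weight_ge0.
Qed.

Let measurable_share B C a s : (forall e, measurable (B e)) -> measurable C ->
  measurable_fun setT (fun x : lobs R m n => ((\1_(slice C (relative a)) x)%:E *
    (edge_weight B s (aggregate hm M x (relative a)))%:E)%E).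
Proof.
move=> mB mC; apply: emeasurable_funM; apply/measurable_EFinP.
  by apply: measurable_indic; exact: measurable_slice.
exact: (measurableT_comp (measurable_edge_weight s mB) (measurable_aggregate hm M (relative a))).
Qed.

Let share_shift B C a t s : a \in aligns -> (forall e, measurable (B e)) ->
  measurable C -> share B C a s = share B C (shift t a) s.
Proof.
move=> ha mB mC; rewrite /share relative_shift.
apply: (same_pushforward_integral _ _ (measurable_share a s mB mC)) => //.
- by move=> A mA; exact: rest_shift.
- by move=> x; rewrite mule_ge0// lee_fin// edge_weight_ge0.
Qed.

(** The conditional probability of the event [B] about the first graph given that
    the aggregate is [y], the second permutation being uniform. *)
Definition average_weight (B : edge n -> set R) (y : graph R n) : R :=
  #|{perm 'I_n}|%:R^-1 * \sum_s edge_weight B s y.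

Let perms_gt0 : 0 < #|{perm 'I_n}|%:R :> R.
Proof. by rewrite ltr0n; apply/card_gt0P; exists 1%g. Qed.

(* The left-hand side is unchanged when all the alignments are shifted by [t],
   which moves [t] into the last argument of [share]; averaging over [t] makes
   that argument uniform. *)
Let sum_share B C : (forall e, measurable (B e)) -> measurable C ->
  (\sum_(a in aligns) share B C a (a (val (second hm))) =
   \sum_(a in aligns) \int[given a]_w ((\1_(slice C (relative a)) (rest (X w)))%:E *
     (average_weight B (aggregate hm M (rest (X w)) (relative a)))%:E))%E.
Proof.
move=> mB mC; set k2 := val (second hm).
set S := LHS.
have S0 : (0 <= S)%E by apply: sume_ge0 => a _; exact: share_ge0.
have St t : S = (\sum_(a in aligns) share B C a (t * a k2)%g)%E.
  rewrite /S (reindex_inj (can_inj (shiftK t))).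
  under eq_bigl do rewrite shift_aligns.
  apply: eq_bigr => a ha; rewrite /k2 shift_later.
  by rewrite -share_shift.
have NS : (#|{perm 'I_n}|%:R%:E * S = \sum_(a in aligns) \sum_s share B C a s)%E.
  transitivity (\sum_(t : {perm 'I_n}) S)%E.
    rewrite -sumr_const -sumEFin ge0_sume_distrl//.
    by apply: eq_bigr => t _; rewrite mul1e.
  transitivity (\sum_(t : {perm 'I_n}) \sum_(a in aligns) share B C a (t * a k2)%g)%E.
    by apply: eq_bigr => t _; exact: St.
  rewrite exchange_big; apply: eq_bigr => a _.
  by rewrite [RHS](reindex_inj (mulIg (a k2))).
have -> : S = ((#|{perm 'I_n}|%:R^-1)%:E * (#|{perm 'I_n}|%:R%:E * S))%E.
  by rewrite muleA -EFinM mulVf ?mul1e// gt_eqF.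
rewrite NS ge0_sume_distrr; last by move=> a _; apply: sume_ge0 => s _; exact: share_ge0.
apply: eq_bigr => a _; rewrite /share -ge0_integral_sum//; last 2 first.
- move=> s; exact: (measurableT_comp (measurable_share a s mB mC) mrestX).
- by move=> s x _; rewrite mule_ge0// lee_fin// edge_weight_ge0.
rewrite -ge0_integralZl//; last 2 first.
- apply: emeasurable_sum => s; exact: (measurableT_comp (measurable_share a s mB mC) mrestX).
- by move=> x _; apply: sume_ge0 => s _; rewrite mule_ge0// lee_fin// edge_weight_ge0.
apply: eq_integral => w _.
rewrite -ge0_sume_distrr; last by move=> s _; rewrite lee_fin edge_weight_ge0.
by rewrite sumEFin muleCA -!EFinM.
Qed.

Let W (w : T) : lobs R m n * relt := (rest (X w), relative (pistar w)).

Let mW : measurable_fun setT W.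
Proof. exact: measurable_relative_pair. Qed.

Let mpreW C : measurable C -> measurable [set w | C (W w)].
Proof. by move=> mC; rewrite -[X in measurable X]setTI; exact: mW. Qed.

Lemma average_weight_ge0 B y : (forall e, measurable (B e)) -> 0 <= average_weight B y.
Proof.
move=> mB; apply: mulr_ge0; first by rewrite invr_ge0 ltW.
by apply: sumr_ge0 => s _; exact: edge_weight_ge0.
Qed.

Lemma measurable_average_weight B : (forall e, measurable (B e)) ->
  measurable_fun setT (average_weight B).
Proof.
move=> mB; apply: measurable_funM => //.
by apply: measurable_sum => s; exact: measurable_edge_weight.
Qed.

(** Sum over the alignments of the conditional laws of [given_alignment]. *)
Lemma planted_conditional (B : edge n -> set R) (C : set (lobs R m n * relt)) :
  (forall e, measurable (B e)) -> measurable C ->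
  P [set w | (forall e, B e (X w f1 e)) /\ C (rest (X w), relative (pistar w))] =
  (\int[P]_(w in [set w | C (rest (X w), relative (pistar w))])
    (average_weight B (aggregate hm M (rest (X w)) (relative (pistar w))))%:E)%E.
Proof.
move=> mB mC.
have mp : measurable_fun setT (fun w =>
    average_weight B (aggregate hm M (rest (X w)) (relative (pistar w)))).
  apply: (measurableT_comp (measurable_average_weight mB)).
  apply: (measurableT_comp (f := fun z : lobs R m n * relt => aggregate hm M z.1 z.2) _ mW).
  by apply: measurable_prod_permfam => t; exact: measurable_aggregate.
have p0 w : 0 <= average_weight B (aggregate hm M (rest (X w)) (relative (pistar w))).
  exact: average_weight_ge0.
have mE := mpreW mC.
have mF := mfirst mB.
rewrite -[RHS]/(density_measure P mp p0 _).
pose E := [set w | C (rest (X w), relative (pistar w))].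
pose F := [set w | forall e, B e (X w f1 e)] `&` E.
have sumP (N : {measure set T -> \bar R}) A : measurable A ->
    (forall a, P (D a) = 0 -> N (A `&` D a) = 0)%E ->
    N A = (\sum_(a in aligns) N (A `&` D a))%E.
  move=> mA N0; rewrite (measure_partition N (f := pistar)); last first.
    by move=> a; apply: measurableI => //; exact: mD.
  rewrite (bigID (mem aligns))/= [X in (_ + X)%E]big1 ?adde0// => a ha.
  by apply: N0; rewrite unif (negbTE ha).
have mFa a : measurable (F `&` D a) by apply: measurableI; [exact: measurableI|exact: mD].
rewrite -[LHS]/(P F) (sumP _ F); last 2 first.
- exact: measurableI.
- move=> a; apply: subset_measure0 => //; exact: subIsetr.
rewrite [RHS]sumP//; last first.
  move=> a Da0; apply: null_set_integral => //; first exact: measurableI.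
    by apply: measurable_funTS; apply/measurable_EFinP.
  by apply: (@subset_measure0 _ _ _ P _ (D a)) => //; exact: measurableI.
transitivity (\sum_(a in aligns) share B C a (a (val (second hm))))%E.
  apply: eq_bigr => a ha.
  have := given_alignment ha mB (measurable_slice (relative a) mC).
  rewrite [X in _ = X -> _]integral_setE => h; apply: (etrans _ h).
  congr (P _); apply/seteqP; split=> w.
    by move=> [[? Ew] Da]; move: Ew; rewrite /E/= Da.
  by move=> [Da [? Cw]]; split=> //; split=> //; rewrite /E/= Da.
rewrite sum_share//; apply: eq_bigr => a ha.
rewrite integral_mrestr//; last 2 first.
- apply: emeasurable_funM; apply/measurable_EFinP.
    have m1 : measurable_fun setT (\1_(slice C (relative a)) : lobs R m n -> R).
      by apply: measurable_indic; exact: measurable_slice.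
    exact: (measurableT_comp m1 mrestX).
  apply: (measurableT_comp (measurable_average_weight mB)).
  exact: (measurableT_comp (measurable_aggregate hm M (relative a)) mrestX).
- by move=> w; rewrite mule_ge0// lee_fin// average_weight_ge0.
rewrite [LHS]integral_setE -[RHS]/(\int[P]_(w in E `&` D a) _)%E [RHS]integral_setE.
apply: eq_integral => w _; rewrite -!EFinM mulrA; congr EFin.
have [wa|wa] := eqVneq (pistar w) a.
  rewrite wa; congr (_ * _); rewrite !indicE -natrM mulnb; congr (nat_of_bool _)%:R.
  by rewrite in_setI andbC /E/slice; congr (_ && _); apply/idP/idP; rewrite !inE/= wa.
rewrite !indicE [w \in D a]memNset ?mul0r; last by apply/eqP.
by rewrite [w \in _]memNset ?mul0r// => -[_ /eqP]; exact/negP.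
Qed.

End planted_model.

(** * The null model *)

Section null_model.
Context (R : realType) (m n : nat) (hm : (3 <= m)%N).
Context (d : measure_display) (T : measurableType d) (P Q : probability T R).
Variables (X : {mfun T >-> obs R m n}) (pistar : {mfun T >-> permfam 'I_m n}).
Variable K : R.-pker (lobs R m n) ~> (relperm m n).
Local Notation f1 := (first hm).
Local Notation relt := (relperm m n).
Hypothesis hQ1 : forall B : 'I_m -> set (graph R n), (forall k, measurable (B k)) ->
  Q [set w | forall k, B k (X w k)] =
  (\prod_(k < m) fine (P [set w | B k (X w k)]))%:E.

Let mrestX : measurable_fun setT (fun w => rest (X w)).
Proof. exact: (measurableT_comp (@measurable_rest R m n) (measurable_funPT X)). Qed.

Let mX1 (B : set (graph R n)) : measurable B -> measurable [set w | B (X w f1)].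
Proof.
move=> mB; rewrite -[X in measurable X]setTI.
exact: (measurableT_comp (measurable_coord (T := graph R n) f1) (measurable_funPT X)).
Qed.

Let null_rectangle (B : set (graph R n)) (A : later m -> set (graph R n)) :
  measurable B -> (forall k, measurable (A k)) ->
  Q [set w | B (X w f1) /\ forall k, A k (rest (X w) k)] =
  (fine (P [set w | B (X w f1)]) *
   \prod_(k : later m) fine (P [set w | A k (X w (val k))]))%:E.
Proof.
move=> mB mA.
pose C (k : 'I_m) : set (graph R n) := if insub k is Some l then A l else B.
have C1 : C f1 = B by rewrite /C insubF.
have CA l : C (val l) = A l by rewrite /C valK.
have mC k : measurable (C k) by rewrite /C; case: insub.
have <- : [set w | forall k, C k (X w k)] =
    [set w | B (X w f1) /\ forall k, A k (rest (X w) k)].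
  apply/seteqP; split=> w /= h.
    by split=> [|k]; [rewrite -C1|rewrite -CA].
  case: h => hB hA k; rewrite /C; case: insubP => [l _ <-|]; first exact: hA.
  rewrite -leqNgt leqn0 => /eqP k0.
  by have -> : k = f1 by exact: val_inj.
rewrite hQ1//; congr EFin.
rewrite (bigD1 f1)//= C1; congr (_ * _).
under [RHS]eq_bigr do rewrite -CA.
rewrite (big_later _ (fun k => fine (P [set w | C k (X w k)]))).
by apply: eq_bigl => k; rewrite lt0n.
Qed.

Lemma null_independent (B : set (graph R n)) : measurable B ->
  forall C, measurable C ->
  Q [set w | B (X w f1) /\ C (rest (X w))] =
  (Q [set w | B (X w f1)] * Q [set w | C (rest (X w))])%E.
Proof.
move=> mB.
have q0 : 0 <= fine (Q [set w | B (X w f1)]) by exact: fine_ge0.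
suff E C : measurable C -> mrestr Q (mX1 mB) [set w | C (rest (X w))] =
    mscale (NngNum q0) Q [set w | C (rest (X w))].
  move=> C mC; rewrite -[X in (X * _)%E]fineK ?fin_num_measure//; last exact: mX1.
  by rewrite -[RHS](E C)//= /mrestr setIC.
have PT : P [set w | [set: graph R n] (X w f1)] = 1%E by exact: probability_setT.
have PTk k : P [set w | [set: graph R n] (X w k)] = 1%E by exact: probability_setT.
have QB : Q [set w | B (X w f1)] = (fine (P [set w | B (X w f1)]))%:E.
  have := null_rectangle (A := fun=> setT) mB (fun=> measurableT).
  rewrite big1 ?mulr1; last by move=> k _; rewrite PTk.
  move=> <-; congr (Q _); apply/seteqP; split=> w //=; last by case.
pose G : set (set (lobs R m n)) := rectangles (@measurable _ (graph R n)).
move: C; apply: (finite_measure_unique (G := G) mrestX).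
- exact: rectangles_measurable.
- apply: rectangles_generate => //; exact: sub_gen_smallest.
- by apply: rectanglesI => A1 A2; exact: measurableI.
- exact: rectanglesT.
- rewrite -ge0_fin_numE ?measure_ge0//; apply: (fin_num_measure Q).
  by apply: measurableI => //; exact: mX1.
move=> _ [A mA ->].
rewrite -[LHS]/(Q ([set w | forall k, A k (rest (X w) k)] `&` [set w | B (X w f1)])).
rewrite setIC [LHS](null_rectangle mB mA).
rewrite -[RHS]/((fine (Q [set w | B (X w f1)]))%:E * Q [set w | forall k, A k (rest (X w) k)])%E.
rewrite QB/=.
have := null_rectangle (B := setT) measurableT mA.
rewrite PT mul1r => E.
rewrite EFinM -E; congr (_ * Q _)%E; apply/seteqP; split=> w //=; last by case.
Qed.

Hypothesis hK : is_posterior P X pistar K.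
Hypothesis hQ2 : forall (A : set (obs R m n)) (B : set relt), measurable A ->
  Q [set w | A (X w) /\ B (relative (pistar w))] =
  (\int[pushforward Q X]_(x in A) K (rest x) B)%E.

Let W (w : T) : lobs R m n * relt := (rest (X w), relative (pistar w)).

(** The kernel [K] at [y] of the section of [C] at [y]. *)
Definition posterior (C : set (lobs R m n * relt)) (y : lobs R m n) : \bar R :=
  (\sum_(t : relt) (\1_(slice C t) y)%:E * K y [set t])%E.

Let posterior_ge0 C y : (0 <= posterior C y)%E.
Proof. by apply: sume_ge0 => t _; rewrite mule_ge0// lee_fin. Qed.

Let posterior_le1 C y : (posterior C y <= 1)%E.
Proof.
apply: (@le_trans _ _ (\sum_(t : relt) K y [set t])%E).
  apply: lee_sum => t _; rewrite -[leRHS]mul1e; apply: lee_wpmul2r => //.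
  by rewrite lee_fin indicE lern1; case: (_ \in _).
rewrite -(prob_kernel (s := K) y) (measure_partition _ (f := fun t : relt => t)); last first.
  by move=> t; exact: measurable_permfam.
by apply: lee_sum => t _; rewrite setTI.
Qed.

Let measurable_posterior_term C t : measurable C ->
  measurable_fun setT (fun y => (\1_(slice C t) y)%:E * K y [set t])%E.
Proof.
move=> mC; apply: emeasurable_funM.
  apply/measurable_EFinP; apply: measurable_indic; exact: measurable_slice.
exact: measurable_kernel.
Qed.

Let measurable_posterior C : measurable C -> measurable_fun setT (posterior C).
Proof. by move=> mC; apply: emeasurable_sum => t; exact: measurable_posterior_term. Qed.

Let sum_slices (N : {measure set T -> \bar R}) (A : set T) C :
  measurable A -> measurable C ->
  N [set w | A w /\ C (W w)] =
  (\sum_(t : relt) N [set w | (A w /\ slice C t (rest (X w))) /\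
                              [set t] (relative (pistar w))])%E.
Proof.
move=> mA mC.
rewrite (measure_partition N (f := fun w => relative (pistar w))); last first.
  move=> t; apply: measurableI.
    apply: measurableI => //; rewrite -[X in measurable X]setTI.
    exact: measurable_relative_pair.
  rewrite -[X in measurable X]setTI.
  exact: (measurableT_comp (measurable_from_permfam (@relative m n)) (measurable_funPT pistar)).
apply: eq_bigr => t _; congr (N _); apply/seteqP; split=> w.
  by move=> [[Aw Cw] wt]; move: Cw; rewrite /W wt; split.
by move=> [[Aw Cw] wt]; split=> //; split=> //; rewrite /W wt.
Qed.

Lemma planted_posterior C : measurable C ->
  P [set w | C (W w)] = (\int[P]_w posterior C (rest (X w)))%E.
Proof.
move=> mC.
have -> : [set w | C (W w)] = [set w | [set: T] w /\ C (W w)].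
  by apply/seteqP; split=> w //=; case.
rewrite (sum_slices P)// ge0_integral_sum//; last first.
  by move=> t; exact: (measurableT_comp (measurable_posterior_term t mC) mrestX).
apply: eq_bigr => t _.
transitivity (\int[law P mrestX]_(y in slice C t) K y [set t])%E.
  rewrite -[RHS]hK//; last exact: measurable_slice.
  congr (P _); apply/seteqP; split=> w; first by move=> [[_ Cw] wt].
  by move=> [Cw wt].
rewrite [LHS]integral_setE.
apply: (etrans (ge0_integral_law P mrestX measurableT (measurable_posterior_term t mC) _)).
  by move=> y; rewrite mule_ge0// lee_fin.
by rewrite preimage_setT.
Qed.

Let null_posterior_on (B : set (graph R n)) C : measurable B -> measurable C ->
  Q [set w | B (X w f1) /\ C (W w)] =
  (\int[Q]_(w in [set w | B (X w f1)]) posterior C (rest (X w)))%E.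
Proof.
move=> mB mC.
rewrite [LHS](sum_slices Q (mX1 mB) mC) ge0_integral_sum//; last 2 first.
- exact: mX1.
- move=> t; apply: measurable_funTS.
  exact: (measurableT_comp (measurable_posterior_term t mC) mrestX).
apply: eq_bigr => t _.
pose A : set (obs R m n) := [set x | B (x f1) /\ slice C t (rest x)].
have mA : measurable A.
  apply: measurableI; rewrite -[X in measurable X]setTI.
    exact: (measurable_coord (T := graph R n) f1).
  by apply: measurable_rest => //; exact: measurable_slice.
have mKr : measurable_fun setT (fun x : obs R m n => K (rest x) [set t]).
  exact: (measurableT_comp (measurable_kernel K _ (measurable_permfam [set t])) (@measurable_rest R m n)).
transitivity (\int[law Q (measurable_funPT X)]_(x in A) K (rest x) [set t])%E.
  by rewrite -[RHS]hQ2.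
rewrite (ge0_integral_law Q (measurable_funPT X) mA mKr)//.
rewrite [LHS]integral_setE [RHS]integral_setE; apply: eq_integral => w _.
rewrite muleA -EFinM; congr (_%:E * _)%E; rewrite !indicE -natrM mulnb.
congr (nat_of_bool _)%:R; apply/idP/idP.
  by rewrite inE => -[? ?]; apply/andP; rewrite !inE.
by move=> /andP[]; rewrite !inE.
Qed.

Lemma null_posterior C : measurable C ->
  Q [set w | C (W w)] = (\int[Q]_w posterior C (rest (X w)))%E.
Proof.
move=> mC; have := null_posterior_on measurableT mC.
by move=> E; apply: (etrans _ E); congr (Q _); apply/seteqP; split=> w //=; case.
Qed.

Lemma null_first_independent (B : set (graph R n)) C :
  measurable B -> measurable C ->
  Q [set w | B (X w f1) /\ C (W w)] =
  (Q [set w | B (X w f1)] * Q [set w | C (W w)])%E.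
Proof.
move=> mB mC; rewrite null_posterior_on// null_posterior//.
have q0 : 0 <= fine (Q [set w | B (X w f1)]) by exact: fine_ge0.
transitivity (\int[mscale (NngNum q0) Q]_w posterior C (rest (X w)))%E; last first.
  rewrite ge0_integral_mscale//=; first by rewrite fineK// fin_num_measure//; exact: mX1.
  exact: (measurableT_comp (measurable_posterior mC) mrestX).
rewrite -(integral_mrestr Q (mX1 mB)); last 2 first.
- exact: (measurableT_comp (measurable_posterior mC) mrestX).
- by move=> w.
apply: (same_pushforward_integral mrestX _ (measurable_posterior mC)) => // A mA.
rewrite -[LHS]/(Q ([set w | A (rest (X w))] `&` [set w | B (X w f1)])) setIC.
rewrite [LHS](null_independent mB mA).
rewrite -[RHS]/((fine (Q [set w | B (X w f1)]))%:E * Q [set w | A (rest (X w))])%E.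
by rewrite fineK// fin_num_measure//; exact: mX1.
Qed.

(** Both laws are obtained from the ones of X^2, ..., X^m by the kernel [K]. *)
Lemma tv_posterior (mW : measurable_fun setT W) :
  tv (law P mW) (law Q mW) <= tv (law P mrestX) (law Q mrestX).
Proof.
apply: tv_le => C mC.
have E (N : probability T R) : (\int[N]_w posterior C (rest (X w)) =
    \int[law N mrestX]_y posterior C y)%E.
  by rewrite (ge0_integral_law N mrestX measurableT (measurable_posterior mC))// preimage_setT.
have := tv_integral (law P mrestX) (law Q mrestX) (measurable_posterior mC).
rewrite -!E -planted_posterior// -null_posterior//.
have Wfin (N : probability T R) : N [set w | C (W w)] \is a fin_num.
  by apply: (fin_num_measure (law N mW)).
rewrite -[X in (X <= _)%E]fineK// -[X in (_ <= X + _)%E]fineK// -EFinD lee_fin.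
rewrite -lerBlDl; apply => y.
by rewrite posterior_ge0 posterior_le1.
Qed.

End null_model.

(** * The inequality *)

Section assembling.
Context (R : realType) (m n : nat) (hm : (3 <= m)%N).
Local Notation f1 := (first hm).

Definition from_first_and_rest (z : graph R n * (lobs R m n * relperm m n)) : obs R m n :=
  fun k => if insub k is Some l then z.2.1 l else z.1.

Lemma measurable_from_first_and_rest : measurable_fun setT from_first_and_rest.
Proof.
apply: measurable_fun_prodspace => k; rewrite /from_first_and_rest.
case: insub => [l|]; last exact: measurable_fst.
exact: (measurableT_comp (measurable_coord (T := graph R n) l)
  (measurableT_comp measurable_fst measurable_snd)).
Qed.

Lemma from_first_and_restE (x : obs R m n) t :
  from_first_and_rest (x f1, (rest x, t)) = x.
Proof.
apply/funext => k; rewrite /from_first_and_rest/=.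
case: insubP => [l _ <- //|]; rewrite -leqNgt leqn0 => /eqP k0.
by congr x; exact: val_inj.
Qed.

Lemma cylinders_rectangles :
  @cylinders (edge n) _ R `<=` rectangles (@measurable _ R).
Proof.
move=> _ [e _ [B mB <-]].
exists (fun e' => if e' == e then B else setT); first by move=> e'; case: ifP.
rewrite setTI; apply/seteqP; split=> x /=; last by move=> /(_ e); rewrite eqxx.
by move=> Bx e'; case: eqVneq => // ->.
Qed.

Lemma cylindersC : setC_closed (@cylinders (edge n) _ R).
Proof.
move=> _ [e _ [B mB <-]]; exists e => //; exists (~` B); first exact: measurableC.
by rewrite !setTI preimage_setC.
Qed.

End assembling.

Theorem theorem4p1 (R : realType) (m n : nat) (hm : (3 <= m)%N)
  (M : model R) (hM : admissible M)
  (d : measure_display) (T : measurableType d) (P Q : probability T R)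
  (X : {mfun T >-> obs R m n}) (pistar : {mfun T >-> permfam 'I_m n})
  (K : R.-pker (lobs R m n) ~> (relperm m n))
  (hP : planted hm M P X pistar) (hK : is_posterior P X pistar K)
  (hQ : null P Q X pistar K) :
  tv (pushforward P X) (pushforward Q X) <=
  tv (pushforward P (fun w => first_and_aggregate hm M (X w) (pistar w)))
     (pushforward Q (fun w => first_and_aggregate hm M (X w) (pistar w)))
  + 4 * tv (pushforward P (fun w => rest (X w)))
           (pushforward Q (fun w => rest (X w))).
Proof.
have [unif [mu [hmu indep]]] := hP.
have [hQ1 hQ2] := hQ.
have [kappa hkappa] := edge_law_first_given_aggregate hm hM hmu.
pose W w : lobs R m n * relperm m n := (rest (X w), relative (pistar w)).
have mW : measurable_fun setT W by exact: measurable_relative_pair.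
have mrestX : measurable_fun setT (fun w => rest (X w)).
  exact: (measurableT_comp (@measurable_rest R m n) (measurable_funPT X)).
have mX1 : measurable_fun setT (fun w => X w (first hm)).
  exact: (measurableT_comp (measurable_coord (T := graph R n) (first hm)) (measurable_funPT X)).
pose Z w : graph R n * (lobs R m n * relperm m n) := (X w (first hm), W w).
have mZ : measurable_fun setT Z by exact: measurable_fun_pair.
pose agg (z : lobs R m n * relperm m n) : graph R n := aggregate hm M z.1 z.2.
have magg : measurable_fun setT agg.
  by apply: measurable_prod_permfam => t; exact: measurable_aggregate.
pose BB : set (set (graph R n)) := rectangles (@measurable _ R).
have BBm : BB `<=` measurable by exact: rectangles_measurable.
have le_law : tv (pushforward P X) (pushforward Q X) <= tv (law P mZ) (law Q mZ).
  apply: (@tv_le _ _ _ (law P (measurable_funPT X)) (law Q (measurable_funPT X))) => A mA.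
  have mfA : measurable (@from_first_and_rest R m n @^-1` A).
    by rewrite -[X in measurable X]setTI; exact: measurable_from_first_and_rest.
  have E (N : probability T R) : law N (measurable_funPT X) A =
      law N mZ (@from_first_and_rest R m n @^-1` A).
    by congr (N _); apply/seteqP; split=> w /=; rewrite /Z/W from_first_and_restE.
  by rewrite !E; exact: tv_ge.
have HP B : BB B -> exists g : graph R n -> \bar R,
    [/\ measurable_fun setT g, forall y, (0 <= g y)%E &
        forall C, measurable C -> law P mZ (B `*` C) =
          (\int[law (law P mZ) measurable_snd]_(x in C) g (agg x))%E].
  move=> [b mb ->]; exists (fun y => (average_weight kappa b y)%:E).
  have mg := measurable_average_weight hkappa mb.
  split=> [|y|C mC]; first by apply/measurable_EFinP.
    by rewrite lee_fin (average_weight_ge0 hkappa).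
  have := planted_conditional unif indep hkappa mb mC.
  move=> E; apply: (etrans E).
  have mgagg : measurable_fun setT (fun z => (average_weight kappa b (agg z))%:E).
    by apply/measurable_EFinP; exact: (measurableT_comp mg magg).
  have g0 z : (0 <= (average_weight kappa b (agg z))%:E)%E.
    by rewrite lee_fin (average_weight_ge0 hkappa).
  apply/esym; apply: (etrans (ge0_integral_law (law P mZ) measurable_snd mC mgagg g0)).
  have mC2 : measurable (snd @^-1` C : set (graph R n * (lobs R m n * relperm m n))).
    by rewrite -[X in measurable X]setTI; exact: measurable_snd.
  exact: (ge0_integral_law P mZ mC2 (measurableT_comp mgagg measurable_snd) (fun z => g0 z.2)).
have HQ' B C : BB B -> measurable C -> law Q mZ (B `*` C) =
    (law Q mZ (B `*` setT) * law (law Q mZ) measurable_snd C)%E.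
  move=> hB mC; have E := null_first_independent hm hQ1 hQ2 (BBm _ hB) mC.
  apply: (etrans E); congr (Q _ * Q _)%E; apply/seteqP; split=> w //=; last by case.
have := tv_conditional_independence magg (erefl : @measurable _ (graph R n) = <<s @cylinders (edge n) _ R>>) (@cylindersC R n)
  (@cylinders_rectangles R n) (@rectanglesT _ _ _ measurableT) _ BBm HP HQ'.
have BBI : setI_closed BB by apply: rectanglesI => A1 A2; exact: measurableI.
move=> /(_ BBI) main.
have tv0 : 0 <= tv (law P mrestX) (law Q mrestX).
  by apply: le_trans (tv_ge _ _ measurable0); rewrite !measure0 subrr.
have post : tv (law (law P mZ) measurable_snd) (law (law Q mZ) measurable_snd) <=
    tv (law P mrestX) (law Q mrestX).
  exact: (tv_posterior hm hK hQ2 mW).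
apply: (le_trans le_law); apply: (le_trans main); apply: lerD; first exact: lexx.
apply: (@le_trans _ _ (2 * tv (law P mrestX) (law Q mrestX))).
  by rewrite ler_pM2l.
by apply: ler_wpM2r => //; rewrite ler_nat.
Qed.
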